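(* Let $\mathcal{G}=\bigcup_{k=1}^{s}G_k$ be a graphical cake represented by a finite graph with $s$ connected components $G_1,\dots,G_s$, where $G_k$ has radius $r_k$, and let $r=\max_k r_k$. Let two agents $A,B$ have valuations $v_A,v_B$ on $\mathcal{G}$ and let $0\le t\le1$ with entitlement vector $(t,1-t)$. Then there exists a weighted consensus division $(\alpha,\beta)$ of $\mathcal{G}$ in which the total number of connected components of $\alpha$ plus that of $\beta$ is at most $s+2r+4$. More precisely, the division can be chosen so that either (i) $s-1$ of the components $G_k$ are each contained wholly in $\alpha$ or wholly in $\beta$, and the remaining component $G_i$ is divided so that $\alpha\cap G_i$ and $\beta\cap G_i$ each have at most $r+2$ connected components; or (ii) $s-2$ of the components $G_k$ are each contained wholly in $\alpha$ or wholly in $\beta$, and the remaining two components $G_i,G_j$ are divided so that $\alpha\cap(G_i\cup G_j)$ and $\beta\cap(G_i\cup G_j)$ each have at most $r+3$ connected components.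
   Context: A graphical cake represented by a finite graph (loops and multiple edges allowed) consists of one closed interval per edge, with endpoints identified according to the incidence structure of the graph. A piece is a finite union of subintervals of edges; its connected pieces are its path components under the endpoint identifications. The radius of a connected graph is $\min_v\max_w d(v,w)$ with $d$ the graph distance. A valuation is a non-atomic Borel probability measure on the cake. A division between two agents is a pair of pieces $(\alpha,\beta)$ with $\alpha\cup\beta=\mathcal{G}$ and $\alpha\cap\beta$ finite. Given entitlements $(t,1-t)$, $0\le t\le1$, a division is a weighted consensus division if $v_A(\alpha)=v_B(\alpha)=t$ and $v_A(\beta)=v_B(\beta)=1-t$. *)

(* Defs.v *)
From HB Require Import structures.
From mathcomp Require Import all_boot all_order all_algebra.
From mathcomp Require Import all_classical all_reals all_analysis.
From Stdlib Require Import Relations.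

Set Implicit Arguments.
Unset Strict Implicit.
Unset Printing Implicit Defensive.

Import Order.TTheory GRing.Theory Num.Theory.
Local Open Scope classical_set_scope.
Local Open Scope ring_scope.

(* A finite multigraph (loops and multiple edges allowed) is given by a
   finite vertex type V, a finite edge type E and the two endpoint maps
   src, tgt : E -> V (the orientation is irrelevant below). *)

Section GraphCake.
Variables (R : realType) (V E : finType) (src tgt : E -> V).

Definition adj : rel V :=
  fun u w => [exists e : E, ((src e == u) && (tgt e == w))
                         || ((src e == w) && (tgt e == u))].

Fixpoint dist_le (n : nat) (u w : V) : bool :=
  match n with
  | 0 => u == w
  | n'.+1 => dist_le n' u w || [exists x, dist_le n' u x && adj x w]
  end.

(* graph distance (only used between vertices of a common component,
   where a shortest walk has length < #|V|) *)
Definition dist (u w : V) : nat :=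
  find (fun n => dist_le n u w) (iota 0 #|V|).

Definition gcomp (v : V) : {set V} := [set w | connect adj v w].

Definition gcomps : {set {set V}} := [set gcomp v | v in V].

Definition graph_radius (C : {set V}) : nat :=
  \big[minn/#|V|]_(v in C) \max_(w in C) dist v w.

(* Points of the cake: vertices, or interior points (e, x), 0 < x < 1. *)
Definition gcake_point := (V + (E * R))%type.

Definition pt (e : E) (x : R) : gcake_point :=
  if x == 0 then inl (src e) else if x == 1 then inl (tgt e) else inr (e, x).

Definition cake : set gcake_point :=
  [set p | exists e x, 0 <= x <= 1 /\ p = pt e x].

Definition cake_of (C : {set V}) : set gcake_point :=
  [set p | exists e x, src e \in C /\ 0 <= x <= 1 /\ p = pt e x].

Definition slice (P : set gcake_point) (e : E) : set R :=
  [set x | 0 <= x <= 1 /\ P (pt e x)].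

Definition piece (P : set gcake_point) : Prop :=
  P `<=` cake /\
  forall e, exists s : seq (interval R),
      slice P e = \bigcup_(i in [set` s]) [set x | x \in i].

Definition seg (P : set gcake_point) (p q : gcake_point) : Prop :=
  exists e a b, 0 <= a /\ a <= b /\ b <= 1 /\
    (forall x, a <= x <= b -> P (pt e x)) /\ p = pt e a /\ q = pt e b.

Definition pconn (P : set gcake_point) : gcake_point -> gcake_point -> Prop :=
  clos_refl_sym_trans gcake_point (seg P).

Definition at_most_comps (P : set gcake_point) (n : nat) : Prop :=
  exists f : 'I_n -> gcake_point, forall p, P p -> exists i, pconn P (f i) p.

(* A non-atomic Borel probability measure on the cake is encoded by its
   restrictions to the edges: one Borel measure per edge, supported on
   [0,1], non-atomic, with total mass 1 (the finitely many identified
   endpoints carry no mass). *)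
Definition valuation (mu : E -> {measure set R -> \bar R}) : Prop :=
  (forall e, mu e (~` `[0%R, 1%R]%classic) = 0%E) /\
  (forall e (y : R), mu e [set y] = 0%E) /\
  (\sum_(e : E) mu e `[0%R, 1%R]%classic = 1%E)%E.

Definition value (mu : E -> {measure set R -> \bar R}) (P : set gcake_point) : \bar R :=
  (\sum_(e : E) mu e (slice P e))%E.

Definition division (a b : set gcake_point) : Prop :=
  piece a /\ piece b /\ a `|` b = cake /\ finite_set (a `&` b).

End GraphCake.

(* Main.v *)
(** Root every connected component at a centre and lay its edges end to end in
    the depth-first order of a breadth-first tree; a non-tree edge hangs from one
    of its endpoints as a pendant edge. Placing the components one after the other
    turns the cake into a segment [[0, #|E|]]. An initial part of a component is
    connected, through the centre. A part of a component starting inside an edge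
    [e] splits into the piece hanging below that cut and one piece for each vertex
    on the tree path from [e] up to the centre: at most [radius + 2] pieces. In the
    complement of an interval, the group at the centre merges with the initial
    part. On the other hand, two non-atomic measures on a circle always have a
    common arc of measure [t], and an arc of the circle is an interval of the
    segment or the complement of one. *)
Require Import Defs.
From Stdlib Require Import Relations.
From HB Require Import structures.
From mathcomp Require Import all_boot all_order all_algebra.
From mathcomp Require Import all_classical all_reals all_analysis.
From mathcomp Require Import ring lra zify.
Set Implicit Arguments.
Unset Strict Implicit.
Unset Printing Implicit Defensive.
Import Order.TTheory GRing.Theory Num.Theory.
Import numFieldNormedType.Exports.

(** The tree is breadth-first so that tree paths are no longer than the radius, and the order is
    depth-first so that everything hanging below an edge is consecutive. A final part therefore
    costs one for the cut itself and at most [radius + 1] for the vertices of one tree path.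
    Forgetting that a non-tree edge also meets its far endpoint can only overcount components. The
    circle serves the measures alone: the two ends of the segment are not joined in the cake, and
    the complement of an interval is treated as an initial part together with a final part. *)

Lemma lexi_cons_nat (x y : nat) (p s : seqlexi nat) :
  ((x :: p : seqlexi nat) <= (y :: s : seqlexi nat))%O =
  (x <= y) && ((y <= x) ==> (p <= s)%O).
Proof. by []. Qed.

(** This is the contiguity of subtrees in preorder: keys of edges are words, and the key of a
    descendant extends that of its ancestor. *)
Lemma lexi_prefix_convex (p s t : seqlexi nat) :
  (p <= s)%O -> (s <= (p ++ t : seqlexi nat))%O -> prefix p s.
Proof.
elim: p s => [|x p IH] [|y s] //=.
rewrite !lexi_cons_nat; case: ltngtP => //= _; exact: IH.
Qed.

(** * Graph distance and centres of components *)

Section GraphDistance.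
Variables (V E : finType) (src tgt : E -> V).

Local Notation adj := (adj src tgt).
Local Notation dist_le := (dist_le src tgt).
Local Notation dist := (dist src tgt).
Local Notation gcomp := (gcomp src tgt).
Local Notation radius := (graph_radius src tgt).

Lemma adj_sym : symmetric adj.
Proof.
by move=> u w; rewrite /adj; apply: eq_existsb => e; rewrite orbC.
Qed.

Lemma connect_adj_sym : connect_sym adj.
Proof. exact: sym_connect_sym adj_sym. Qed.

Lemma gcomp_eq u w : connect adj u w -> gcomp u = gcomp w.
Proof.
by move=> uw; apply/setP => x; rewrite !inE (same_connect connect_adj_sym uw).
Qed.

Lemma mem_gcomp u w : (w \in gcomp u) = connect adj u w.
Proof. by rewrite inE. Qed.

Lemma gcomp_src_tgt e : gcomp (src e) = gcomp (tgt e).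
Proof.
by apply/gcomp_eq/connect1; apply/existsP; exists e; rewrite !eqxx.
Qed.

Lemma path_dist_le u p : path adj u p -> dist_le (size p) u (last u p).
Proof.
elim/last_ind: p => [|p x IH] //=.
rewrite rcons_path size_rcons last_rcons => /andP[/IH up px] /=.
by apply/orP; right; apply/existsP; exists (last u p); rewrite up px.
Qed.

Lemma dist_min m u w : dist_le m u w -> dist u w <= m.
Proof.
move=> um; rewrite leqNgt; apply/negP => lt.
have mV : m < #|V|.
  by apply: leq_trans lt _; rewrite -[X in _ <= X](size_iota 0) find_size.
by have := before_find 0 lt; rewrite nth_iota// add0n um.
Qed.

Lemma dist_dist_le u w : connect adj u w -> dist_le (dist u w) u w.
Proof.
case/connectP => p0 up0 ->.
(* A walk without repeated vertices has length below [#|V|], hence inside the range searched by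
   [dist]. *)
case: (shortenP up0) => p up uniqp _.
have szp : size p < #|V| by rewrite -[(size p).+1]/(size (u :: p)) -(card_uniqP uniqp) max_card.
have hasp : has (fun n => dist_le n u (last u p)) (iota 0 #|V|).
  by apply/hasP; exists (size p); [rewrite mem_iota|exact: path_dist_le].
have := nth_find 0 hasp; rewrite nth_iota ?add0n //.
by rewrite -[X in _ < X](size_iota 0) -has_find.
Qed.

Lemma dist_size u w : dist u w <= #|V|.
Proof. by rewrite -[X in _ <= X](size_iota 0) find_size. Qed.

Lemma dist_eq0 u w : connect adj u w -> dist u w = 0 -> u = w.
Proof. by move=> /dist_dist_le + d0; rewrite d0 => /eqP. Qed.

Lemma dist_pred u w n : connect adj u w -> dist u w = n.+1 ->
  exists2 x, adj x w & dist u x = n.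
Proof.
move=> uw dn; have := dist_dist_le uw; rewrite dn /=.
case/orP => [/dist_min|/existsP[x /andP[ux xw]]]; first by rewrite dn ltnn.
exists x => //; apply/eqP; rewrite eqn_leq dist_min//=.
have cux : connect adj u x.
  by rewrite (connect_trans uw)// connect_adj_sym connect1.
rewrite -ltnS -dn; apply: dist_min => /=; apply/orP; right; apply/existsP.
by exists x; rewrite dist_dist_le.
Qed.

Lemma radius_center (C : {set V}) v0 : v0 \in C ->
  exists2 v, v \in C & [forall w in C, dist v w <= radius C].
Proof.
move=> v0C.
(* The minimum may take its default value [#|V|]; every vertex is then a centre, since [dist] never
   exceeds [#|V|]. *)
have [->|[v vC ->]] : radius C = #|V| \/
    exists2 v, v \in C & radius C = \max_(w in C) dist v w.
- rewrite /graph_radius; elim/big_rec: _ => [|v m vC IH]; first by left.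
  rewrite /minn; case: ifP => _; last exact: IH.
  by right; exists v.
- by exists v0 => //; apply/'forall_implyP => w _; exact: dist_size.
- by exists v => //; apply/'forall_implyP => w wC; exact: leq_bigmax_cond.
Qed.

(** By [radius_center] the default [v] is never returned, so the centre depends on [v] only through
    its component. *)
Definition comp_center (v : V) : V :=
  odflt v [pick u in gcomp v | [forall w in gcomp v, dist u w <= radius (gcomp v)]].

Lemma center_spec v :
  connect adj (comp_center v) v /\ dist (comp_center v) v <= radius (gcomp v).
Proof.
have vv : v \in gcomp v by rewrite mem_gcomp connect0.
rewrite /comp_center; case: pickP => [u /andP[uv /'forall_implyP H]|H] /=.
  by split; [rewrite connect_adj_sym -mem_gcomp|exact: H].
by have [u uC Hu] := radius_center vv; have := H u; rewrite uC Hu.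
Qed.

Lemma center_gcomp u v : gcomp u = gcomp v -> comp_center u = comp_center v.
Proof.
move=> uv; rewrite /comp_center uv; case: pickP => //= H.
have vv : v \in gcomp v by rewrite mem_gcomp connect0.
by have [x xC Hx] := radius_center vv; have := H x; rewrite xC Hx.
Qed.

(** * The breadth-first tree and the depth-first order of the edges *)

Definition depth (v : V) : nat := dist (comp_center v) v.

Definition tree_edge (w : V) : option E :=
  [pick e | ((src e == w) && ((depth (tgt e)).+1 == depth w))
         || ((tgt e == w) && ((depth (src e)).+1 == depth w))].

(* Tree edges are oriented away from the centre of their component. *)
Definition flipped (e : E) : bool := tree_edge (src e) == Some e.
Definition start_vertex (e : E) : V := if flipped e then tgt e else src e.
Definition stop_vertex (e : E) : V := if flipped e then src e else tgt e.

Lemma gcomp_start e : gcomp (start_vertex e) = gcomp (src e).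
Proof. by rewrite /start_vertex gcomp_src_tgt; case: ifP => // _; rewrite gcomp_src_tgt. Qed.

Lemma gcomp_stop e : gcomp (stop_vertex e) = gcomp (src e).
Proof. by rewrite /stop_vertex gcomp_src_tgt; case: ifP => // _; rewrite gcomp_src_tgt. Qed.

Lemma tree_edgeP w e : tree_edge w = Some e ->
  stop_vertex e = w /\ (depth (start_vertex e)).+1 = depth w.
Proof.
rewrite /stop_vertex /start_vertex /flipped => He.
have : ((src e == w) && ((depth (tgt e)).+1 == depth w))
         || ((tgt e == w) && ((depth (src e)).+1 == depth w)).
  by move: He; rewrite /tree_edge; case: pickP => // x Hx [<-].
case/orP => /andP[/eqP ew /eqP dw]; first by rewrite ew He eqxx.
(* No edge is the parent edge of both its ends: each end would have to be deeper than the other. *)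
case: eqP => // He'; suff : False by [].
move: He'; rewrite /tree_edge; case: pickP => // x Hx [xe]; subst x.
case/orP: Hx => /andP[/eqP ew' /eqP dw'].
  by move: dw; rewrite -ew -dw' => /eqP; rewrite eqn_leq ltnNge leqnSn.
by move: dw'; apply/eqP; rewrite eqn_leq ltnn.
Qed.

Lemma tree_edge_None w : tree_edge w = None -> w = comp_center w.
Proof.
have [cw _] := center_spec w.
case dw : (depth w) => [|n]; first by move=> _; rewrite (dist_eq0 cw dw).
have [x xw dx] := dist_pred cw dw.
have cx : comp_center x = comp_center w by apply/center_gcomp/gcomp_eq/connect1.
have dx' : depth x = n by rewrite /depth cx.
case/existsP: xw => e He; rewrite /tree_edge; case: pickP => // H _.
have := H e; rewrite dw; case/orP: He => /andP[/eqP -> /eqP ->].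
  by rewrite dx' !eqxx orbT.
by rewrite dx' !eqxx.
Qed.

(** The fuel is the depth of [w]: a step to the parent lowers the depth by one, so the fuel runs out
    exactly at the centre. *)
Fixpoint tree_path_rec (n : nat) (w : V) : seq E :=
  if n is n'.+1 then
    if tree_edge w is Some e then rcons (tree_path_rec n' (start_vertex e)) e else [::]
  else [::].
Definition tree_path w := tree_path_rec (depth w) w.

Lemma tree_pathE w e : tree_edge w = Some e ->
  tree_path w = rcons (tree_path (start_vertex e)) e.
Proof.
by move=> He; have [_ dw] := tree_edgeP He; rewrite /tree_path -dw /= He.
Qed.

Lemma size_tree_path w : size (tree_path w) <= depth w.
Proof.
rewrite /tree_path; move: (depth w) => n; elim: n w => [|n IH] w //=.
by case: (tree_edge w) => //= e; rewrite size_rcons ltnS.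
Qed.

(* Sorting by these keys lists the components one after the other, each of them
   in depth-first preorder. *)
Definition edge_key (e : E) : seqlexi nat :=
  nat_of_ord (enum_rank (gcomp (src e))) ::
  [seq nat_of_ord (enum_rank x) | x <- rcons (tree_path (start_vertex e)) e].

Definition edge_order : rel E := fun e e' => (edge_key e <= edge_key e')%O.
Definition edge_rank (e : E) : nat := index e (sort edge_order (enum E)).

Lemma edge_rank_inj : injective edge_rank.
Proof.
by move=> e e'; apply: (index_inj e); rewrite mem_sort mem_enum.
Qed.

Lemma edge_rank_lt e : edge_rank e < #|E|.
Proof.
by rewrite cardE -(size_sort edge_order) index_mem mem_sort mem_enum.
Qed.

Lemma edge_rank_key e e' : edge_rank e <= edge_rank e' ->
  (edge_key e <= edge_key e')%O.
Proof.
have tr : transitive edge_order by move=> ? ? ?; exact: le_trans.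
have to : total edge_order by move=> ? ?; exact: le_total.
rewrite leq_eqVlt => /orP[/eqP /edge_rank_inj -> //|].
by apply: (sorted_ltn_index tr (sort_sorted to (enum E)));
  rewrite mem_sort mem_enum.
Qed.

Lemma edge_key_rank e e' : (edge_key e < edge_key e')%O ->
  edge_rank e < edge_rank e'.
Proof.
by rewrite !ltNge => /negP H; rewrite ltnNge; apply/negP => /edge_rank_key.
Qed.

Lemma edge_key_parent e e' : tree_edge (start_vertex e) = Some e' ->
  exists x, edge_key e = edge_key e' ++ [:: x].
Proof.
move=> He; have [st _] := tree_edgeP He.
exists (nat_of_ord (enum_rank e)).
rewrite /edge_key (tree_pathE He) map_rcons -cats1 cat_cons.
by rewrite -(gcomp_start e) -st gcomp_stop.
Qed.

Lemma edge_rank_parent e e' : tree_edge (start_vertex e) = Some e' ->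
  edge_rank e' < edge_rank e.
Proof.
move=> /edge_key_parent[x Hx]; apply: edge_key_rank.
rewrite Hx lt_neqAle; apply/andP; split.
  by apply/negP => /eqP /(congr1 size); rewrite size_cat addn1 => /eqP; rewrite eqn_leq ltnn andbF.
by elim: (edge_key e') => [|y s IH] //=; rewrite lexi_cons_nat leqnn.
Qed.

(** The first letter of a key numbers the component, so each component occupies a block of
    consecutive ranks. *)
Lemma edge_rank_gcomp_convex e1 e2 e3 :
  edge_rank e1 <= edge_rank e2 -> edge_rank e2 <= edge_rank e3 ->
  gcomp (src e1) = gcomp (src e3) -> gcomp (src e2) = gcomp (src e1).
Proof.
move=> /edge_rank_key + /edge_rank_key; rewrite /edge_key.
rewrite !lexi_cons_nat.
move=> /andP[h1 _] /andP[h2 _] E13.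
apply/enum_rank_inj/ord_inj/eqP; rewrite eqn_leq h1 andbT.
by rewrite E13.
Qed.

(** The parent edge precedes [e] in preorder. An initial part containing [e] thus contains the whole
    tree path back to the centre. *)
Lemma start_center_or_stop e :
  start_vertex e = comp_center (src e) \/
  exists2 e', edge_rank e' < edge_rank e & stop_vertex e' = start_vertex e.
Proof.
case He : (tree_edge (start_vertex e)) => [e'|].
  by right; exists e'; [exact: edge_rank_parent|case: (tree_edgeP He)].
by left; rewrite (tree_edge_None He) (center_gcomp (gcomp_start e)).
Qed.

(* The parent of a later edge [e'] has a key that is a prefix of the key of [e'];
   if it comes before [e], then the key of [e] is squeezed between the two, so
   the parent lies on the tree path to [e]. *)
Lemma start_ancestor_or_stop e : exists A : seq V,
  [/\ size A <= (radius (gcomp (src e))).+1, comp_center (src e) \in A &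
   forall e', gcomp (src e') = gcomp (src e) -> edge_rank e < edge_rank e' ->
     start_vertex e' \in A \/
     exists2 e'', edge_rank e <= edge_rank e'' < edge_rank e' & stop_vertex e'' = start_vertex e'].
Proof.
(* These are the vertices of the tree path from the centre to the start of [e], one more than its
   edges. *)
exists (comp_center (src e) :: map stop_vertex (tree_path (start_vertex e))); split.
- rewrite /= size_map ltnS (leq_trans (size_tree_path _))//.
  by have [_] := center_spec (start_vertex e); rewrite gcomp_start.
- exact: mem_head.
move=> e' Ce' ee'; case He : (tree_edge (start_vertex e')) => [e''|]; last first.
  left; rewrite (tree_edge_None He) (center_gcomp (gcomp_start e')).
  by rewrite (center_gcomp Ce') mem_head.
have [st _] := tree_edgeP He; have lt := edge_rank_parent He.
have [le|gt] := leqP (edge_rank e) (edge_rank e'').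
  by right; exists e'' => //; rewrite le lt.
left; rewrite -st inE; apply/orP; right; apply: map_f.
have [x Hx] := edge_key_parent He.
have := edge_rank_key (ltnW ee'); rewrite Hx.
move=> /(lexi_prefix_convex (edge_rank_key (ltnW gt))) /prefixP[s].
rewrite /edge_key cat_cons => -[_ Emap].
have : nat_of_ord (enum_rank e'') \in
    [seq nat_of_ord (enum_rank x) | x <- rcons (tree_path (start_vertex e)) e].
  rewrite Emap mem_cat; apply/orP; left.
  by apply: (map_f (fun x => nat_of_ord (enum_rank x))); rewrite mem_rcons mem_head.
rewrite (mem_map (f := fun x => nat_of_ord (enum_rank x))); last first.
  by move=> ? ? /ord_inj /enum_rank_inj.
rewrite mem_rcons inE => /orP[/eqP ee|//].
by move: gt; rewrite ee ltnn.
Qed.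

End GraphDistance.

(** * Common arcs of two continuous distribution functions *)

Local Open Scope classical_set_scope.
Local Open Scope ring_scope.

(** At most one of the two terms on the left is nonzero, so their sum is [D] rotated by [t] on the
    circle, written so that its continuity is evident. Rotated minus original is nonpositive where
    [D] is maximal and nonnegative where it is minimal; the intermediate value theorem gives a
    zero. *)
Lemma circle_translate (R : realType) (D : R -> R) (t : R) :
  continuous D -> (forall x, x <= 0 -> D x = 0) -> (forall x, 1 <= x -> D x = 0) ->
  0 <= t <= 1 ->
  exists2 u, 0 <= u <= 1 & D (u + t) + D (u + t - 1) = D u.
Proof.
move=> cD D0 D1 t01.
have [a a01 amax] := EVT_max (@ler01 R) (continuous_subspaceT cD).
have [b b01 bmin] := EVT_min (@ler01 R) (continuous_subspaceT cD).
rewrite !in_itv/= in a01 b01.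
pose h u := D (u + t) + D (u + t - 1) - D u.
have ch : continuous h.
  move=> x; apply: cvgB; last exact: cD.
  apply: cvgD.
    apply: (@continuous_comp _ _ _ (fun u => u + t)); last exact: cD.
    by apply: cvgD; [exact: cvg_id|exact: cvg_cst].
  apply: (@continuous_comp _ _ _ (fun u => u + t - 1)); last exact: cD.
  apply: cvgB; last exact: cvg_cst.
  by apply: cvgD; [exact: cvg_id|exact: cvg_cst].
have shift u : 0 <= u <= 1 -> exists2 v, v \in `[0, 1]%R & h u = D v - D u.
  move=> u01; have [le1|gt1] := leP (u + t) 1.
    exists (u + t); first by rewrite in_itv/=; lra.
    by rewrite /h (D0 (u + t - 1)) ?addr0//; lra.
  exists (u + t - 1); first by rewrite in_itv/=; lra.
  by rewrite /h (D1 (u + t)) ?add0r//; lra.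
have ha : h a <= 0.
  by have [v v01 ->] := shift a a01; rewrite subr_le0; exact: amax.
have hb : 0 <= h b.
  by have [v v01 ->] := shift b b01; rewrite subr_ge0; exact: bmin.
suff [u u01 hu] : exists2 u, 0 <= u <= 1 & h u = 0.
  by exists u => //; apply/eqP; rewrite -subr_eq0; apply/eqP.
have [ab|/ltW ba] := leP a b.
  have [|c] := IVT (v := 0) ab (continuous_subspaceT ch).
    by rewrite ge_min le_max ha hb orbT.
  by rewrite in_itv/= => cab hc; exists c => //; lra.
have [|c] := IVT (v := 0) ba (continuous_subspaceT ch).
  by rewrite ge_min le_max ha hb orbT.
by rewrite in_itv/= => cab hc; exists c => //; lra.
Qed.

(* Reparametrise by the mean of [F] and [G]: with [q] a right inverse of
   [(F + G) / 2], the function [F \o q - id] is Lipschitz and vanishes at both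
   ends, and two parameters at circle distance [t] where it takes equal values
   delimit the required arc. *)
Lemma common_quantile_arc (R : realType) (F G : R -> R) (m t : R) :
  0 <= m -> continuous F -> continuous G ->
  {homo F : x y / x <= y} -> {homo G : x y / x <= y} ->
  F 0 = 0 -> G 0 = 0 -> F m = 1 -> G m = 1 -> 0 <= t <= 1 ->
  exists x y, [/\ 0 <= x, x <= y, y <= m &
    (F y - F x = t /\ G y - G x = t) \/
    (F y - F x = 1 - t /\ G y - G x = 1 - t)].
Proof.
move=> m0 cF cG hF hG F0 G0 F1 G1 t01.
have [u|q Hq] := @boolp.choice R R (fun u q => 0 <= u <= 1 ->
    (0 <= q <= m) /\ F q + G q = 2 * u).
  have [u01|nu] := boolP (0 <= u <= 1); last by exists 0.
  have cS : continuous (fun x => F x + G x).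
    by move=> x; apply: cvgD; [exact: cF|exact: cG].
  have [|c] := IVT (v := 2 * u) m0 (continuous_subspaceT cS).
    rewrite F0 G0 F1 G1 ge_min le_max.
    by apply/andP; split; apply/orP; [left|right]; lra.
  by rewrite in_itv/= => c0m cE; exists c.
(* The increments of [F] and [G] have the same sign and add up to [2 * (v - u)]. This holds even
   where [q] decreases: both increments are then zero. *)
have lip u v : 0 <= u -> u <= v -> v <= 1 ->
    0 <= F (q v) - F (q u) <= 2 * (v - u).
  move=> u0 uv v1.
  have [_ Eu] := Hq u (ltac:(lra)); have [_ Ev] := Hq v (ltac:(lra)).
  have [/[dup] /hF ? /hG ?|/ltW /[dup] /hF ? /hG ?] := leP (q u) (q v); lra.
(* Clamping extends the function [F \o q - id] to the whole line by its end values, which are zero,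
   as [circle_translate] requires. *)
pose c u : R := Num.max 0 (Num.min u 1).
have cP u : [\/ u <= 0 /\ c u = 0, 1 <= u /\ c u = 1 | 0 <= u <= 1 /\ c u = u].
  rewrite /c; have [u1|u1] := leP u 1.
    by have [u0|u0] := leP 0 u; [apply: Or33|apply: Or31]; split => //; lra.
  by apply: Or32; rewrite max_r ?ler01//; lra.
pose D u := F (q (c u)) - c u.
have end0 : F (q 0) = 0.
  have [/andP[q0 qm] E] := Hq 0 (ltac:(lra)).
  by have := hF _ _ q0; have := hG _ _ q0; rewrite F0 G0 => ? ?; lra.
have end1 : F (q 1) = 1.
  have [/andP[q0 qm] E] := Hq 1 (ltac:(lra)).
  by have := hF _ _ qm; have := hG _ _ qm; rewrite F1 G1 => ? ?; lra.
have D0 u : u <= 0 -> D u = 0.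
  by rewrite /D; case: (cP u) => -[? ->] ?; rewrite ?end0 ?end1; [lra..|]; 
    have -> : u = 0 by [lra|]; rewrite end0; lra.
have D1 u : 1 <= u -> D u = 0.
  by rewrite /D; case: (cP u) => -[? ->] ?; rewrite ?end0 ?end1; [lra..|]; 
    have -> : u = 1 by [lra|]; rewrite end1; lra.
have lipD u v : u <= v -> `|D u - D v| <= 2 * (v - u).
  move=> uv; rewrite ler_norml /D.
  have [cu cv cuv] : [/\ 0 <= c u, c v <= 1 & c u <= c v /\ c v - c u <= v - u].
    by case: (cP u) => -[? ->]; case: (cP v) => -[? ->]; split=> //; lra.
  by have := lip _ _ cu cuv.1 cv; move: cuv => [] *; lra.
have cD : continuous D.
  move=> x; apply/cvgrPdist_le => e e0; near=> y.
  have yx : `|x - y| <= e / 2.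
    by near: y; apply: (@cvgr_dist_le _ _ _ _ _ id); [exact: cvg_id|lra].
  have [xy|/ltW xy] := leP x y.
    by have := lipD _ _ xy; move: yx; rewrite distrC ger0_norm ?subr_ge0//; lra.
  have := lipD _ _ xy; rewrite distrC.
  by move: yx; rewrite ger0_norm ?subr_ge0//; lra.
have [u u01 Du] := circle_translate cD D0 D1 t01.
have mono a b : 0 <= a -> a <= b -> b <= 1 -> a = b \/ q a <= q b.
  move=> a0 ab b1; have [->|nab] := eqVneq a b; [by left|right].
  rewrite leNgt; apply/negP => /ltW lt.
  have [_ Ea] := Hq a (ltac:(lra)); have [_ Eb] := Hq b (ltac:(lra)).
  have ltab : a < b by rewrite lt_neqAle nab.
  by have := hF _ _ lt; have := hG _ _ lt; lra.
have cid v : 0 <= v <= 1 -> c v = v by case: (cP v) => -[? ->] ?; lra.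
(* Equal values of [D] mean that [F] grows by as much as the parameter; the two increments sum to
   twice that, so [G] grows equally. When the arc wraps around, the interval left out of it has
   increment [1 - t]. *)
have [le1|gt1] := leP (u + t) 1.
  rewrite (D0 (u + t - 1)) ?addr0 in Du; last lra.
  move: Du; rewrite /D !cid; [|lra..] => Du.
  have [/andP[? ?] Eu] := Hq u u01.
  have [/andP[? ?] Ev] := Hq (u + t) (ltac:(lra)).
  exists (q u), (q (u + t)); split=> //.
    by case: (mono u (u + t)) => [|||<-//|//]; lra.
  by left; split; lra.
rewrite (D1 (u + t)) ?add0r in Du; last lra.
move: Du; rewrite /D !cid; [|lra..] => Du.
have [/andP[? ?] Eu] := Hq u u01.
have [/andP[? ?] Ev] := Hq (u + t - 1) (ltac:(lra)).
exists (q (u + t - 1)), (q u); split=> //.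
  by case: (mono (u + t - 1) u) => [|||->//|//]; lra.
by right; split; lra.
Unshelve. all: by end_near.
Qed.

(** * The distribution function of a measure on one oriented edge *)

Section EdgeMeasure.
Variables (R : realType) (mu : {measure set R -> \bar R}) (flip : bool).
Hypotheses (mu_supp : mu (~` `[0, 1]%classic) = 0%E)
  (mu_pt : forall y : R, mu [set y] = 0%E)
  (mu_fin : (mu `[0%R, 1%R]%classic < +oo)%E).

Local Notation o := (fun x : R => if flip then 1 - x else x).

Lemma measurable_orient_le c : measurable [set x | o x <= c].
Proof.
have := @measurable_itv R `[1 - c, +oo[; have := @measurable_itv R `]-oo, c].
case: flip => m1 m2; [apply: eq_rect m2 _ _|apply: eq_rect m1 _ _];
  apply/seteqP; split=> x /=; rewrite ?in_itv/= ?andbT; lra.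
Qed.

Lemma measurable_orient_ge c : measurable [set x | c <= o x].
Proof.
have := @measurable_itv R `]-oo, 1 - c]; have := @measurable_itv R `[c, +oo[.
case: flip => m1 m2; [apply: eq_rect m2 _ _|apply: eq_rect m1 _ _];
  apply/seteqP; split=> x /=; rewrite ?in_itv/= ?andbT; lra.
Qed.

Lemma measurable_orient_itv a b : measurable [set x | a <= o x <= b].
Proof.
have -> : [set x | a <= o x <= b] = [set x | a <= o x] `&` [set x | o x <= b].
  by apply/seteqP; split=> x /=; [move=> /andP|move=> [-> ->]].
exact: measurableI (measurable_orient_ge a) (measurable_orient_le b).
Qed.

Let mu_le A B : measurable A -> measurable B -> A `<=` B -> (mu A <= mu B)%E.
Proof. by move=> mA mB AB; apply: le_measure; rewrite ?inE. Qed.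

Let mu_U2 A B : measurable A -> measurable B -> (mu (A `|` B) <= mu A + mu B)%E.
Proof. exact: measureU2. Qed.

Let mu_le0 A : (mu A <= 0)%E -> mu A = 0%E.
Proof. by move=> h; apply/eqP; rewrite eq_le h measure_ge0. Qed.

Let mu_split A B : measurable A -> measurable B ->
  mu A = (mu (A `&` B) + mu (A `&` ~` B))%E.
Proof.
move=> mA mB; rewrite -{1}(setIT A) -(setUv B) setIUr; apply: measureU.
- exact: measurableI.
- by apply: measurableI => //; exact: measurableC.
- by rewrite setIACA setICr setI0.
Qed.

Lemma measure_seq0 (s : seq R) : measurable [set` s] /\ mu [set` s] = 0%E.
Proof.
elim: s => [|x s [ms IH]].
  by rewrite set_nil; split; [exact: measurable0|exact: measure0].
have -> : [set` x :: s] = [set x] `|` [set` s].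
  apply/seteqP; split=> y /=; rewrite inE; first by case/orP => [/eqP|]; [left|right].
  by case=> [->|->]; rewrite ?eqxx ?orbT.
split; first exact: measurableU.
by apply: mu_le0; apply: le_trans (mu_U2 _ _) _ => //; rewrite mu_pt IH adde0.
Qed.

Lemma measure_interior (A : set R) : measurable A -> mu A = mu (A `&` `]0, 1[%classic).
Proof.
move=> mA.
rewrite (mu_split mA (measurable_itv `]0, 1[)).
suff -> : mu (A `&` ~` `]0, 1[%classic) = 0%E by rewrite adde0.
apply: mu_le0.
have [m01 z01] := measure_seq0 [:: 0; 1].
have mC : measurable (~` `[(0:R), 1]%classic) by exact: measurableC.
have -> : 0%E = (mu (~` `[0%R, 1%R]%classic) + mu [set` [:: 0%R; 1%R]])%E.
  by rewrite mu_supp z01 adde0.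
apply: le_trans (mu_U2 _ _) => //; apply: mu_le.
- by apply: measurableI => //; exact: measurableC.
- exact: measurableU.
move=> x [_] /=; rewrite !in_itv/= !inE => nx.
have [/andP[h0 h1]|/negP] := boolP (0 <= x <= 1); last by left.
right; apply/negPn/negP; rewrite negb_or => /andP[x0 x1].
by apply: nx; rewrite !lt_neqAle h0 h1 eq_sym x0 x1.
Qed.

(** Whether the ends of an edge belong to a slice depends on the other edges at those vertices. They
    carry no mass, so slices can be replaced by explicit intervals. *)
Lemma measure_eq_interior (A B : set R) : measurable A -> measurable B ->
  (forall x, 0 < x < 1 -> A x <-> B x) -> mu A = mu B.
Proof.
move=> mA mB AB; rewrite measure_interior // [RHS]measure_interior //.
congr (mu _); apply/seteqP; split=> x [h] /[dup] x01 /=; rewrite in_itv /= => h01.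
  by split=> //; apply/AB.
by split=> //; apply/AB.
Qed.

Lemma measure_orient_fin (A : set R) : measurable A -> mu A \is a fin_num.
Proof.
move=> mA; rewrite ge0_fin_numE //; apply: le_lt_trans mu_fin.
rewrite measure_interior //; apply: mu_le.
- exact: measurableI.
- exact: measurable_itv.
- by move=> x [_] /=; rewrite !in_itv /= => /andP[/ltW -> /ltW ->].
Qed.

Definition edge_cdf (c : R) : R := fine (mu [set x | o x <= c]).

Lemma edge_cdfE c : (edge_cdf c)%:E = mu [set x | o x <= c].
Proof. by rewrite fineK // measure_orient_fin //; exact: measurable_orient_le. Qed.

Lemma edge_cdf0 c : c <= 0 -> edge_cdf c = 0.
Proof.
move=> c0; apply: EFin_inj; rewrite edge_cdfE.
transitivity (mu set0); last exact: measure0.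
apply: measure_eq_interior => //; first exact: measurable_orient_le.
by move=> x x01 /=; case: flip; split => //; lra.
Qed.

Lemma edge_cdf1 c : 1 <= c -> (edge_cdf c)%:E = mu `[0%R, 1%R]%classic.
Proof.
move=> c1; rewrite edge_cdfE; apply: measure_eq_interior => //.
  exact: measurable_orient_le.
by move=> x x01 /=; rewrite in_itv /=; case: flip; split => //; lra.
Qed.

Lemma edge_cdf_itv a b : a <= b ->
  mu [set x | a <= o x <= b] = (edge_cdf b - edge_cdf a)%:E.
Proof.
move=> ab; have mab := measurable_orient_itv a b.
(* The orientation is its own inverse, so [o a] is the only point where [o x = a], the overlap of
   the two parts below. *)
have [mo zo] := measure_seq0 [:: o a].
have ma := measurable_orient_le a.
rewrite EFinB !edge_cdfE.
have -> : [set x | o x <= b] = [set x | o x <= a] `|` [set x | a <= o x <= b].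
  apply/seteqP; split=> x /=.
    by move=> xb; case: (leP (if flip then 1 - x else x) a) => [?|/ltW ?]; [left|right; apply/andP].
  by move=> [?|?]; lra.
rewrite measureUfinr //; last by rewrite -ge0_fin_numE// measure_orient_fin.
have -> : mu ([set x | o x <= a] `&` [set x | a <= o x <= b]) = 0%E.
  apply: mu_le0; rewrite -[leRHS]zo; apply: mu_le => //; first exact: measurableI.
  by move=> x /= [xa /andP[ax _]]; rewrite inE; apply/eqP; move: xa ax; case: flip; lra.
by rewrite sube0 addeAC subee ?add0e // measure_orient_fin.
Qed.

Lemma measurable_orient_outside a b : measurable [set x | o x <= a \/ b <= o x].
Proof. exact: measurableU (measurable_orient_le a) (measurable_orient_ge b). Qed.

Lemma edge_cdf_outside a b : a <= b ->
  mu [set x | o x <= a \/ b <= o x] = (edge_cdf a + (edge_cdf 1 - edge_cdf b))%:E.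
Proof.
move=> ab; have [mo zo] := measure_seq0 [:: o a].
have ma := measurable_orient_le a; have mb := measurable_orient_ge b.
have -> : [set x | o x <= a \/ b <= o x] = [set x | o x <= a] `|` [set x | b <= o x] by [].
rewrite measureUfinr //; last by rewrite -ge0_fin_numE// measure_orient_fin.
have -> : mu ([set x | o x <= a] `&` [set x | b <= o x]) = 0%E.
  apply: mu_le0; rewrite -[leRHS]zo; apply: mu_le => //; first exact: measurableI.
  by move=> x /= [xa bx]; rewrite inE; apply/eqP; move: xa bx; case: flip; lra.
rewrite sube0 EFinD edge_cdfE; congr (_ + _)%E.
(* [b] may exceed 1; the interval is closed at the larger of the two, since the distribution
   function is constant from 1 on. *)
have b1 : b <= Num.max b 1 by rewrite le_max lexx.
have -> : edge_cdf 1 = edge_cdf (Num.max b 1).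
  have h1 : 1 <= Num.max b 1 by rewrite le_max lexx orbT.
  by apply: EFin_inj; rewrite (edge_cdf1 h1) (edge_cdf1 (lexx 1)).
rewrite -edge_cdf_itv //; apply: measure_eq_interior => //.
  exact: measurable_orient_itv.
move=> x x01 /=; rewrite le_max; case: flip.
  have -> : 1 - x <= 1 by lra.
  by rewrite orbT andbT.
have -> : x <= 1 by lra.
by rewrite orbT andbT.
Qed.

Lemma edge_cdf_homo : {homo edge_cdf : x y / x <= y}.
Proof.
move=> x y xy; rewrite -subr_ge0 -lee_fin -edge_cdf_itv //.
Qed.

(** Closed intervals around [c] shrink to a single null point, so their measures tend to 0 by
    continuity from above; monotonicity turns this into a bound on the oscillation near [c]. *)
Lemma edge_cdf_continuous : continuous edge_cdf.
Proof.
suff cvg_at (c : R) : edge_cdf x @[x --> c] --> edge_cdf c by move=> c; exact: cvg_at.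
have [d [d0 dlt dle]] : exists d : nat -> R, [/\ forall n, 0 < d n,
    forall e : R, 0 < e -> exists n, d n < e & forall m n, (m <= n)%N -> d n <= d m].
  exists (fun n => n.+1%:R^-1); split=> [n|e e0|m n mn]; first by rewrite invr_gt0.
    by exists (Num.truncn e^-1); rewrite invf_plt ?posrE// truncnS_gt.
  by rewrite lef_pV2 ?posrE ?ler_nat.
pose F n := [set x : R | c - d n <= o x <= c + d n].
have mF n : measurable (F n) by exact: measurable_orient_itv.
have capF : \bigcap_n F n = [set` [:: o c]].
  apply/seteqP; split=> x /=.
    move=> Fx; rewrite inE; apply/eqP.
    suff : (if flip then 1 - x else x) = c by case: flip; lra.
    apply/eqP; rewrite -subr_eq0 -normr_le0; apply/ler_addgt0Pr => e /dlt [n ne].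
    have := Fx n Logic.I; rewrite /F /= ler_norml; move: (if flip then _ else _) => y.
    by move=> ?; lra.
  rewrite inE => /eqP -> n _; rewrite /F /=.
  by have := d0 n; case: flip => ?; lra.
have [ms zs] := measure_seq0 [:: o c].
have /fine_cvgP[_ cvF] : mu (F n) @[n --> \oo] --> 0%:E.
  rewrite -[X in _ --> X]zs -capF; apply: nonincreasing_cvg_mu => //.
  - by rewrite -ge0_fin_numE // measure_orient_fin.
  - by rewrite capF.
  - move=> n m nm; apply/subsetPset => x; rewrite /F /=.
    by have := dle _ _ nm; move: (if flip then _ else _) => y ? ?; lra.
apply/cvgrPdist_le => e e0.
have /cvgr0Pnorm_le /(_ e e0) [n _ /(_ n (leqnn n)) Hn] := cvF.
have dn0 := d0 n.
have FnE : fine (mu (F n)) = edge_cdf (c + d n) - edge_cdf (c - d n).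
  by rewrite edge_cdf_itv //; lra.
near=> y.
have cy : `|c - y| <= d n.
  by near: y; apply: (@cvgr_dist_le _ _ _ _ _ id); [exact: cvg_id|].
move: cy; rewrite ler_norml => cy.
have h1 : edge_cdf (c - d n) <= edge_cdf y by apply: edge_cdf_homo; lra.
have h2 : edge_cdf y <= edge_cdf (c + d n) by apply: edge_cdf_homo; lra.
have h3 : edge_cdf (c - d n) <= edge_cdf c by apply: edge_cdf_homo; lra.
have h4 : edge_cdf c <= edge_cdf (c + d n) by apply: edge_cdf_homo; lra.
move: Hn; rewrite /= FnE => /(le_trans (ler_norm _)) Hn.
by rewrite ler_norml; lra.
Unshelve. all: by end_near.
Qed.

End EdgeMeasure.

(** * Oriented coordinates, order of positions, connectivity of parts of a component *)

Section GraphicalCake.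
Variables (R : realType) (V E : finType) (src tgt : E -> V).

Local Notation point := (gcake_point R V E).
Local Notation pt := (@pt R V E src tgt).
Local Notation pconn := (@pconn R V E src tgt).
Local Notation gcomp := (gcomp src tgt).
Local Notation gcomps := (gcomps src tgt).
Local Notation radius := (graph_radius src tgt).
Local Notation flipped := (flipped src tgt).
Local Notation start := (start_vertex src tgt).
Local Notation stop := (stop_vertex src tgt).
Local Notation rank := (edge_rank src tgt).
Local Notation center := (comp_center src tgt).
Local Notation GC := (@cake_of R V E src tgt).

(** Exchanges the coordinate from source to target with the one from [start_vertex] to
    [stop_vertex]. *)
Definition orient (e : E) (z : R) : R := if flipped e then 1 - z else z.
Definition opt (e : E) (z : R) : point := pt e (orient e z).

Lemma orientK e : involutive (orient e).
Proof. by move=> z; rewrite /orient; case: (flipped e); rewrite ?subKr. Qed.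

Lemma orient_unit e z : (0 <= orient e z <= 1) = (0 <= z <= 1).
Proof. by rewrite /orient; case: ifP => // _; apply/idP/idP => ?; lra. Qed.

Lemma pt_opt e x : pt e x = opt e (orient e x).
Proof. by rewrite /opt orientK. Qed.

Lemma pt0 e : pt e 0 = inl (src e).
Proof. by rewrite /Defs.pt eqxx. Qed.

Lemma pt1 e : pt e 1 = inl (tgt e).
Proof. by rewrite /Defs.pt oner_eq0 eqxx. Qed.

Lemma opt0 e : opt e 0 = inl (start e).
Proof.
by rewrite /opt /orient /start_vertex; case: ifP => _; rewrite ?subr0 (pt0, pt1).
Qed.

Lemma opt1 e : opt e 1 = inl (stop e).
Proof.
by rewrite /opt /orient /stop_vertex; case: ifP => _; rewrite ?subrr (pt0, pt1).
Qed.

Lemma opt_cases e z : 0 <= z <= 1 ->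
  (exists v, opt e z = inl v) \/
  (0 < z < 1 /\ opt e z = inr (e, orient e z)).
Proof.
move=> z01.
have [->|z0] := eqVneq z 0; first by left; rewrite opt0; exists (start e).
have [->|z1] := eqVneq z 1; first by left; rewrite opt1; exists (stop e).
have z01' : 0 < z < 1 by rewrite !lt_neqAle eq_sym z0 z1.
right; split=> //; rewrite /opt /Defs.pt ifF ?ifF //;
  by apply/eqP; rewrite /orient; case: (flipped e) => ?; lra.
Qed.

Lemma eq_opt e z e' z' : 0 <= z <= 1 -> 0 <= z' <= 1 -> opt e z = opt e' z' ->
  (exists v, opt e z = inl v) \/ (e = e' /\ z = z').
Proof.
move=> z01 z01'; case: (opt_cases e z01) => [|[_ ->]]; first by left.
case: (opt_cases e' z01') => [[v ->]//|[_ -> [<- Ez]]].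
by right; split=> //; apply: (inv_inj (orientK e)).
Qed.

Definition point_gcomp (p : point) : {set V} :=
  match p with inl v => gcomp v | inr (e, _) => gcomp (src e) end.

Lemma point_gcomp_pt e x : point_gcomp (pt e x) = gcomp (src e).
Proof.
rewrite /Defs.pt; case: ifP => _ //; case: ifP => _ //=.
by rewrite gcomp_src_tgt.
Qed.

Lemma point_gcomp_opt e z : point_gcomp (opt e z) = gcomp (src e).
Proof. exact: point_gcomp_pt. Qed.

Lemma gcomps_mem C v : C \in gcomps -> (v \in C) = (gcomp v == C).
Proof.
case/imsetP => u _ ->; rewrite mem_gcomp; apply/idP/eqP => [/gcomp_eq ->//|Euv].
by rewrite connect_adj_sym -mem_gcomp Euv mem_gcomp connect0.
Qed.

Lemma cake_ofP C p : C \in gcomps ->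
  GC C p <-> exists e z, [/\ 0 <= z <= 1, gcomp (src e) = C & p = opt e z].
Proof.
move=> CG; split=> [[e [x]]|[e [z [z01 eC ->]]]].
  rewrite gcomps_mem // => -[/eqP eC [x01 ->]].
  by exists e, (orient e x); rewrite orient_unit pt_opt.
by exists e, (orient e z); rewrite gcomps_mem // eC eqxx orient_unit.
Qed.

Lemma pconn_sub (P Q : set point) p q : P `<=` Q -> pconn P p q -> pconn Q p q.
Proof.
move=> PQ; elim => [{}p {}q [e [a [b [a0 [ab [b1 [H pq]]]]]]]|x|x y _ IH|x y z _ IH1 _ IH2].
- by apply: rst_step; exists e, a, b; do !split => //; [move=> x /H /PQ|case: pq..].
- exact: rst_refl.
- exact: rst_sym.
- exact: rst_trans IH1 IH2.
Qed.

Lemma pconn_opt (P : set point) e a b : 0 <= a -> a <= b -> b <= 1 ->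
  (forall z, a <= z <= b -> P (opt e z)) -> pconn P (opt e a) (opt e b).
Proof.
move=> a0 ab b1 H; case fe : (flipped e).
  apply: rst_sym; apply: rst_step; exists e, (1 - b), (1 - a).
  do !split; [lra..| |by rewrite /opt /orient fe|by rewrite /opt /orient fe].
  move=> x xab; have := H (1 - x); rewrite /opt /orient fe subKr; apply; lra.
apply: rst_step; exists e, a, b.
do !split; [lra..| |by rewrite /opt /orient fe|by rewrite /opt /orient fe].
by move=> x xab; have := H x; rewrite /opt /orient fe; apply.
Qed.

(* Positions along the cake are compared lexicographically rather than through
   the real number [rank e + z]: the far end of an edge and the near end of the
   next one share that number but are in general different points. *)
Definition before (e : E) (z : R) (e' : E) (z' : R) : Prop :=
  (rank e < rank e')%N \/ (e = e' /\ z <= z').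

Lemma before_total e z e' z' : before e z e' z' \/ before e' z' e z.
Proof.
rewrite /before; case: (ltngtP (rank e) (rank e')); [by left; left|by right; left|].
move=> /edge_rank_inj ->; case: (leP z z'); first by left; right.
by move=> /ltW; right; right.
Qed.

Lemma before_trans e z e' z' e'' z'' :
  before e z e' z' -> before e' z' e'' z'' -> before e z e'' z''.
Proof.
move=> [lt|[-> le]] [lt'|[<- le']]; rewrite /before.
- by left; exact: ltn_trans lt lt'.
- by left.
- by left.
- by right; split=> //; exact: le_trans le le'.
Qed.

Lemma before_anti e z e' z' :
  before e z e' z' -> before e' z' e z -> e = e' /\ z = z'.
Proof.
move=> [lt|[-> le]] [lt'|[E' le']].
- by move: (ltn_trans lt lt'); rewrite ltnn.
- by move: lt; rewrite E' ltnn.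
- by move: lt'; rewrite ltnn.
- by split=> //; apply/le_anti; rewrite le.
Qed.

Lemma before_rank e z e' z' : before e z e' z' -> (rank e <= rank e')%N.
Proof. by case=> [/ltnW//|[-> _]]. Qed.

Lemma before_lt e z e' z' : (rank e < rank e')%N -> before e z e' z'.
Proof. by left. Qed.

Lemma before_same e z z' : z <= z' -> before e z e z'.
Proof. by right. Qed.

(** By induction on the rank, going back along the edge to its start and then to an earlier edge
    ending there. [D] is abstract so as to serve a whole component, the part before the first cut
    and the part before the second. *)
Lemma initial_segment_conn (D : E -> R -> Prop) (P : set point) C :
  (forall e z, 0 <= z <= 1 -> gcomp (src e) = C -> D e z -> P (opt e z)) ->
  (forall e z e' z', gcomp (src e) = C -> gcomp (src e') = C ->
    before e' z' e z -> D e z -> D e' z') ->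
  forall e z, 0 <= z <= 1 -> gcomp (src e) = C -> D e z ->
    pconn P (inl (center (src e))) (opt e z).
Proof.
move=> DP Dcl e z; have [n] := ubnP (rank e).
elim: n e z => // n IH e z ken z01 eC De.
have c0 : pconn P (opt e 0) (opt e z).
  apply: pconn_opt; [lra..|] => z' z'z; apply: DP => //; first lra.
  by apply: Dcl De => //; apply: before_same; lra.
case: (start_center_or_stop src tgt e) => [<-|[e' lt ee']].
  by rewrite -opt0.
apply: rst_trans c0; rewrite opt0 -ee' -opt1.
have e'C : gcomp (src e') = C by rewrite -eC -(gcomp_start src tgt e) -ee' gcomp_stop.
have -> : center (src e) = center (src e') by apply: center_gcomp; rewrite eC.
apply: IH => //; [by apply: leq_trans lt _|lra|].
by apply: Dcl De => //; exact: before_lt.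
Qed.

(* The vertices in [A] need not belong to [P]; those outside [P] are connected to
   no other point. *)
Lemma segment_conn (D : E -> R -> Prop) (P : set point) i zi :
  0 <= zi <= 1 ->
  (forall e z, 0 <= z <= 1 -> gcomp (src e) = gcomp (src i) -> D e z ->
    before i zi e z /\ P (opt e z)) ->
  (forall e z e' z', gcomp (src e) = gcomp (src i) ->
     gcomp (src e') = gcomp (src i) ->
     before i zi e' z' -> before e' z' e z -> D e z -> D e' z') ->
  exists A : seq V, [/\ (size A <= (radius (gcomp (src i))).+1)%N,
    center (src i) \in A &
    forall e z, 0 <= z <= 1 -> gcomp (src e) = gcomp (src i) -> D e z ->
      pconn P (opt i zi) (opt e z) \/
      exists2 v, v \in A & pconn P (inl v) (opt e z)].
Proof.
move=> zi01 DP Dcl.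
have [A [sA cA HA]] := start_ancestor_or_stop src tgt i.
exists A; split=> // e z; have [n] := ubnP (rank e).
elim: n e z => // n IH e z ken z01 eC De.
have [bi _] := DP e z z01 eC De.
case: (bi) => [lt|[ie le]]; last first.
  subst e; left; apply: pconn_opt; [lra..|] => z' z'z.
  apply: (DP i z' _ _ _).2 => //; first lra.
  by apply: Dcl De => //; apply: before_same; lra.
have c0 : pconn P (opt e 0) (opt e z).
  apply: pconn_opt; [lra..|] => z' z'z; apply: (DP e z' _ _ _).2 => //; first lra.
  by apply: Dcl De => //; [exact: before_lt|apply: before_same; lra].
(* The way back either meets the tree path to [i] or continues along an edge of rank at least that
   of [i]. That edge may be [i] itself, whose far end still lies after the cut. *)
case: (HA e eC lt) => [stA|[e' /andP[le lt'] ee']].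
  by right; exists (start e) => //; rewrite -opt0.
have e'C : gcomp (src e') = gcomp (src i).
  by rewrite -eC -(gcomp_start src tgt e) -ee' gcomp_stop.
have De' : D e' 1.
  apply: Dcl De => //; last exact: before_lt.
  move: le; rewrite leq_eqVlt => /orP[/eqP /edge_rank_inj <-|]; last exact: before_lt.
  by apply: before_same; lra.
have Ee : opt e' 1 = opt e 0 by rewrite opt1 opt0 ee'.
case: (IH e' 1 _ _ e'C De') => [||cc|[v vA cc]]; [by apply: leq_trans lt' _|lra|left|right].
  by apply: rst_trans c0; rewrite -Ee.
by exists v => //; apply: rst_trans c0; rewrite -Ee.
Qed.

(** Paths may use all of [Q] although only points of [P] are to be reached; the listed points may
    lie outside both. *)
Definition covers (Q P : set point) (l : seq (V + E * R)) :=
  forall p, P p -> exists2 q, q \in l & pconn Q q p.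

Lemma coversU Q P1 P2 l1 l2 : covers Q P1 l1 -> covers Q P2 l2 ->
  covers Q (P1 `|` P2) (l1 ++ l2).
Proof.
move=> c1 c2 p [/c1|/c2] [q ql qp]; exists q => //; rewrite mem_cat ql //.
exact: orbT.
Qed.

Lemma covers_at_most (x0 : point) P l n : (size l <= n)%N -> covers P P l ->
  at_most_comps src tgt P n.
Proof.
move=> ln c; exists (fun i : 'I_n => nth x0 l i) => p /c[q ql qp].
have lt : (index q l < n)%N by apply: leq_trans ln; rewrite index_mem.
by exists (Ordinal lt) => /=; rewrite nth_index.
Qed.

(** * An interval of the segment and its complement *)

Section Arc.
Variables (i j : E) (zi zj : R).
Hypotheses (zi01 : 0 <= zi <= 1) (zj01 : 0 <= zj <= 1).
Hypothesis ij : before i zi j zj.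

Definition cake_arc : set point :=
  [set p | exists e z, [/\ 0 <= z <= 1, p = opt e z, before i zi e z & before e z j zj]].
Definition cake_coarc : set point :=
  [set p | exists e z, [/\ 0 <= z <= 1, p = opt e z & before e z i zi \/ before j zj e z]].

Lemma arc_coarcU : cake_arc `|` cake_coarc = cake src tgt.
Proof.
apply/seteqP; split=> [p [[e [z [z01 -> _ _]]]|[e [z [z01 -> _]]]]|p [e [x [x01 ->]]]].
- by exists e, (orient e z); rewrite orient_unit.
- by exists e, (orient e z); rewrite orient_unit.
- rewrite pt_opt; have z01 : 0 <= orient e x <= 1 by rewrite orient_unit.
  have [?|?] := before_total e (orient e x) i zi.
    by right; exists e, (orient e x); split=> //; left.
  have [?|?] := before_total j zj e (orient e x).
    by right; exists e, (orient e x); split=> //; right.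
  by left; exists e, (orient e x).
Qed.

(** A vertex may enter both sets through different edges. An interior point has only one position,
    so it can be shared only at a cut. *)
Lemma arc_coarcI : finite_set (cake_arc `&` cake_coarc).
Proof.
have fin : finite_set ([set p : point | exists v, p = inl v] `|`
    [set opt i zi; opt j zj]).
  rewrite finite_setU; split; last exact: finite_set2.
  have -> : [set p : point | exists v, p = inl v] = inl @` [set: V].
    by apply/seteqP; split=> p [v]; [move=> ->; exists v|move=> _ <-; exists v].
  by apply: finite_image; exact: finite_finset.
apply: sub_finite_set fin => p [[e [z [z01 -> ie ej]]] [e' [z' [z'01 Ep]]]].
case: (eq_opt z01 z'01 Ep) => [?|[<- <-]]; first by left.
by case=> [ei|je]; right; [left|right];
  [case: (before_anti ie ei)|case: (before_anti ej je)] => -> ->.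
Qed.

(** One edge decides for every component other than those of [i] and [j], because components are
    blocks of consecutive ranks. *)
Definition inside (C : {set V}) : bool :=
  [exists e, (gcomp (src e) == C) && ((rank i < rank e) && (rank e < rank j))%N].

Lemma opt_arc e z : 0 <= z <= 1 -> before i zi e z -> before e z j zj -> cake_arc (opt e z).
Proof. by move=> *; exists e, z. Qed.

Lemma opt_coarc e z : 0 <= z <= 1 -> before e z i zi \/ before j zj e z -> cake_coarc (opt e z).
Proof. by move=> *; exists e, z. Qed.

Lemma gcomp_gcomps v : gcomp v \in gcomps.
Proof. exact: imset_f. Qed.

Section OtherComponent.
Variable C : {set V}.
Hypotheses (CG : C \in gcomps) (Ci : C != gcomp (src i)) (Cj : C != gcomp (src j)).

Lemma inside_all e : inside C -> gcomp (src e) = C ->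
  (rank i < rank e)%N && (rank e < rank j)%N.
Proof.
case/existsP => e' /and3P[/eqP e'C ie' e'j] eC.
apply/andP; split; rewrite ltnNge; apply/negP => le.
  have := edge_rank_gcomp_convex le (ltnW ie') (etrans eC (esym e'C)).
  by move=> Ei; move: Ci; rewrite Ei eC eqxx.
have := edge_rank_gcomp_convex (ltnW e'j) le (etrans e'C (esym eC)).
by move=> Ej; move: Cj; rewrite Ej e'C eqxx.
Qed.

Lemma outside_all e : ~~ inside C -> gcomp (src e) = C ->
  (rank e < rank i)%N || (rank j < rank e)%N.
Proof.
rewrite negb_exists => /forallP /(_ e) + eC; rewrite eC eqxx /= negb_and -!leqNgt.
case/orP; rewrite leq_eqVlt => /orP[/eqP /edge_rank_inj E'|->]; rewrite ?orbT //.
  by move: Ci; rewrite -eC E' eqxx.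
by move: Cj; rewrite -eC E' eqxx.
Qed.

Lemma inside_sub : inside C -> GC C `<=` cake_arc.
Proof.
move=> inC p /(cake_ofP _ CG)[e [z [z01 eC ->]]].
have /andP[? ?] := inside_all inC eC.
by apply: opt_arc => //; exact: before_lt.
Qed.

Lemma outside_sub : ~~ inside C -> GC C `<=` cake_coarc.
Proof.
move=> inC p /(cake_ofP _ CG)[e [z [z01 eC ->]]].
by apply: opt_coarc => //; have /orP[?|?] := outside_all inC eC;
  [left|right]; exact: before_lt.
Qed.

Lemma arc_inside p : cake_arc p -> point_gcomp p = C -> inside C.
Proof.
move=> [e [z [z01 -> /before_rank ie /before_rank ej]]]; rewrite point_gcomp_opt => eC.
apply: contraT => inC; have := outside_all inC eC.
by rewrite !ltnNge ie ej.
Qed.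

Lemma coarc_outside p : cake_coarc p -> point_gcomp p = C -> ~~ inside C.
Proof.
move=> [e [z [z01 -> H]]]; rewrite point_gcomp_opt => eC.
apply/negP => inC; have := inside_all inC eC.
by case: H => /before_rank; rewrite leqNgt => /negbTE ->; rewrite ?andbF.
Qed.

End OtherComponent.

Lemma component_covers C v : C = gcomp v -> covers (GC C) (GC C) [:: inl (center v)].
Proof.
move=> CE p; have CG : C \in gcomps by rewrite CE gcomp_gcomps.
move=> /(cake_ofP _ CG)[e [z [z01 eC ->]]].
exists (inl (center v)); first exact: mem_head.
have <- : center (src e) = center v by apply: center_gcomp; rewrite eC.
apply: (@initial_segment_conn (fun _ _ => True) (GC C) C) => //.
by move=> e' z' z'01 e'C _; apply/cake_ofP => //; exists e', z'.
Qed.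

(** The cut accounts for what hangs below it, the vertices of the tree path above it for the rest. A
    second cut in the same component only shortens the far end and creates no new group. *)
Lemma arc_suffix_covers : exists2 l,
  (size l <= radius (gcomp (src i)) + 2)%N &
  covers cake_arc (cake_arc `&` GC (gcomp (src i))) l.
Proof.
have := @segment_conn
  (fun e z => before i zi e z /\ before e z j zj) cake_arc i zi zi01.
case=> [e z z01 _ [ie ej]|e z e' z' _ _ ie' e'e [_ ej]|A [sA _ HA]].
- by split=> //; exact: opt_arc.
- by split=> //; exact: before_trans ej.
exists (opt i zi :: map inl A); first by rewrite /= size_map; lia.
move=> p [[e [z [z01 -> ie ej]]]] /(cake_ofP _ (gcomp_gcomps _))[e' [z' [_ e'C Ep]]].
have eC : gcomp (src e) = gcomp (src i).
  by rewrite -e'C -(point_gcomp_opt e z) Ep point_gcomp_opt.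
case: (HA e z z01 eC (conj ie ej)) => [c|[v vA c]].
  by exists (opt i zi) => //; exact: mem_head.
by exists (inl v) => //; rewrite inE map_f ?orbT.
Qed.

(** The centre is recorded as a member of the list so that an initial part of the same component
    adds nothing to it. *)
Lemma coarc_suffix_covers : exists2 l,
  (size l <= radius (gcomp (src j)) + 2)%N &
  inl (center (src j)) \in l /\
  forall e z, 0 <= z <= 1 -> gcomp (src e) = gcomp (src j) -> before j zj e z ->
    exists2 q, q \in l & pconn cake_coarc q (opt e z).
Proof.
have := @segment_conn (fun e z => before j zj e z) cake_coarc j zj zj01.
case=> [e z z01 _ je|e z e' z' _ _ je' e'e je|A [sA cA HA]].
- by split=> //; apply: opt_coarc => //; right.
- exact: je'.
exists (opt j zj :: map inl A); first by rewrite /= size_map; lia.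
split; first by rewrite inE map_f ?orbT.
move=> e z z01 eC je.
case: (HA e z z01 eC je) => [c|[v vA c]].
  by exists (opt j zj) => //; exact: mem_head.
by exists (inl v) => //; rewrite inE map_f ?orbT.
Qed.

Lemma coarc_prefix_conn e z : 0 <= z <= 1 -> gcomp (src e) = gcomp (src i) ->
  before e z i zi -> pconn cake_coarc (inl (center (src i))) (opt e z).
Proof.
move=> z01 eC ei; rewrite -(center_gcomp eC).
apply: (@initial_segment_conn (fun e z => before e z i zi) cake_coarc
  (gcomp (src i))) => //.
- by move=> e' z' z'01 _ e'i; apply: opt_coarc => //; left.
- by move=> e1 z1 e2 z2 _ _; exact: before_trans.
Qed.

Lemma one_component_coarc_covers : gcomp (src i) = gcomp (src j) -> exists2 l,
  (size l <= radius (gcomp (src i)) + 2)%N &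
  covers cake_coarc (cake_coarc `&` GC (gcomp (src i))) l.
Proof.
move=> ijC; have [l sl [cl Hl]] := coarc_suffix_covers.
exists l; first by rewrite ijC.
move=> p [[e [z [z01 -> H]]]] /(cake_ofP _ (gcomp_gcomps _))[e' [z' [_ e'C Ep]]].
have eC : gcomp (src e) = gcomp (src i).
  by rewrite -e'C -(point_gcomp_opt e z) Ep point_gcomp_opt.
case: H => [ei|je]; last by apply: Hl => //; rewrite eC.
exists (inl (center (src j))) => //.
by rewrite -(center_gcomp ijC); exact: coarc_prefix_conn.
Qed.

Section TwoComponents.
Hypothesis ijC : gcomp (src i) != gcomp (src j).

Lemma rank_ij : (rank i <= rank j)%N.
Proof. exact: before_rank ij. Qed.

Lemma rank_i_lt e : gcomp (src e) = gcomp (src j) -> (rank i < rank e)%N.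
Proof.
move=> eC; rewrite ltnNge; apply/negP => le.
by have := edge_rank_gcomp_convex le rank_ij eC; move/eqP: ijC; rewrite eC.
Qed.

Lemma rank_lt_j e : gcomp (src e) = gcomp (src i) -> (rank e < rank j)%N.
Proof.
move=> eC; rewrite ltnNge; apply/negP => le.
have := edge_rank_gcomp_convex rank_ij le (esym eC).
by move/eqP: ijC => + Ej; rewrite Ej.
Qed.

(** The unit beyond [radius + 2] is the initial part of the component of [j]. For the complement,
    [i] and [j] exchange roles. *)
Lemma two_components_arc_covers : exists2 l,
  (size l <= radius (gcomp (src i)) + 3)%N &
  covers cake_arc (cake_arc `&` (GC (gcomp (src i)) `|` GC (gcomp (src j)))) l.
Proof.
have [l sl Hl] := arc_suffix_covers.
exists (l ++ [:: inl (center (src j))]); first by rewrite size_cat /=; lia.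
rewrite setIUr; apply: coversU => //.
move=> p [[e [z [z01 -> ie ej]]]] /(cake_ofP _ (gcomp_gcomps _))[e' [z' [_ e'C Ep]]].
have eC : gcomp (src e) = gcomp (src j).
  by rewrite -e'C -(point_gcomp_opt e z) Ep point_gcomp_opt.
exists (inl (center (src j))); first exact: mem_head.
rewrite -(center_gcomp eC).
apply: (@initial_segment_conn (fun e z => before e z j zj) cake_arc
  (gcomp (src j))) => //.
- move=> e1 z1 z101 e1C e1j; apply: opt_arc => //.
  by apply: before_lt; exact: rank_i_lt.
- by move=> e1 z1 e2 z2 _ _; exact: before_trans.
Qed.

Lemma two_components_coarc_covers : exists2 l,
  (size l <= radius (gcomp (src j)) + 3)%N &
  covers cake_coarc (cake_coarc `&` (GC (gcomp (src i)) `|` GC (gcomp (src j)))) l.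
Proof.
have [l sl [_ Hl]] := coarc_suffix_covers.
exists ([:: inl (center (src i))] ++ l); first by rewrite /= addnS ltnS.
rewrite setIUr; apply: coversU => p [[e [z [z01 -> H]]]];
  move=> /(cake_ofP _ (gcomp_gcomps _))[e' [z' [_ e'C Ep]]].
  have eC : gcomp (src e) = gcomp (src i).
    by rewrite -e'C -(point_gcomp_opt e z) Ep point_gcomp_opt.
  exists (inl (center (src i))); first exact: mem_head.
  apply: coarc_prefix_conn => //; case: H => // /before_rank.
  by rewrite leqNgt rank_lt_j.
have eC : gcomp (src e) = gcomp (src j).
  by rewrite -e'C -(point_gcomp_opt e z) Ep point_gcomp_opt.
apply: Hl => //; case: H => // /before_rank.
by rewrite leqNgt rank_i_lt.
Qed.

End TwoComponents.

End Arc.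

(** * Counting the components of both shares *)

Local Notation r := (\max_(C in gcomps) radius C)%N.

(** [Q] gathers the components that are cut; each whole component in [S] costs one more point, its
    centre. *)
Lemma covers_whole_components (P Q : set point) (S : {set {set V}}) l (n : nat) (v0 : V) :
  S \subset gcomps -> (forall C, C \in S -> GC C `<=` P) ->
  (forall p, P p -> Q p \/ exists2 C, C \in S & GC C p) ->
  covers P (P `&` Q) l -> (size l + #|S| <= n)%N ->
  at_most_comps src tgt P n.
Proof.
move=> SG SP PQ cl sz.
pose f (C : {set V}) := odflt v0 [pick v in C].
have fE C : C \in S -> C = gcomp (f C).
  move=> /(fintype.subsetP SG) CG; apply/esym/eqP; rewrite -gcomps_mem // /f.
  case: pickP => //= C0; case/imsetP: (CG) => v _ Cv.
  by have := C0 v; rewrite Cv mem_gcomp connect0.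
apply: (covers_at_most (l := l ++ [seq inl (center (f C)) | C <- enum S]) (inl v0)).
  by rewrite size_cat size_map -cardE.
move=> p Pp; case: (PQ p Pp) => [Qp|[C CS Cp]].
  by have [q ql qp] := cl p (conj Pp Qp); exists q; rewrite // mem_cat ql.
have [q] := component_covers (fE C CS) Cp; rewrite inE => /eqP -> qp.
exists (inl (center (f C))); last exact: pconn_sub (SP C CS) qp.
by rewrite mem_cat; apply/orP; right; apply/mapP; exists C; rewrite ?mem_enum.
Qed.

(** Paths never leave a component, so restricting a piece to some components breaks none of them.
    This turns coverings inside the whole arc into coverings inside its restriction. *)
Lemma pconn_component P p q : pconn P p q ->
  point_gcomp p = point_gcomp q /\
  pconn (P `&` [set x | point_gcomp x = point_gcomp q]) p q.
Proof.
elim=> [{}p {}q [e [a [b [a0 [ab [b1 [H [-> ->]]]]]]]]|x|x y _ [E1 IH]|x y z _ [E1 IH1] _ [E2 IH2]].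
- split; first by rewrite !point_gcomp_pt.
  apply: rst_step; exists e, a, b; do !split => //; first exact: H.
  by rewrite /= !point_gcomp_pt.
- by split=> //; exact: rst_refl.
- by split=> //; apply: rst_sym; rewrite E1.
- by split; [rewrite E1|apply: rst_trans IH2; rewrite -E2].
Qed.

Lemma cake_component p : cake src tgt p -> GC (point_gcomp p) p.
Proof.
move=> [e [x [x01 ->]]]; rewrite point_gcomp_pt; exists e, x.
by rewrite mem_gcomp connect0.
Qed.

Lemma covers_component (P Q : set point) l :
  (forall x y, P x -> Q y -> point_gcomp x = point_gcomp y -> Q x) ->
  covers P (P `&` Q) l -> covers (P `&` Q) (P `&` Q) l.
Proof.
move=> PQ c p [Pp Qp]; have [q ql /pconn_component[_ qp]] := c p (conj Pp Qp).
exists q => //; apply: pconn_sub qp => x [Px xp]; split=> //.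
exact: PQ Px Qp xp.
Qed.

Lemma covers_components (P : set point) (C D : {set V}) l :
  P `<=` cake src tgt -> C \in gcomps -> D \in gcomps ->
  covers P (P `&` (GC C `|` GC D)) l ->
  covers (P `&` (GC C `|` GC D)) (P `&` (GC C `|` GC D)) l.
Proof.
move=> Pc CG DG; apply: covers_component => x y /Pc /cake_component xC.
move=> [/(cake_ofP _ CG)|/(cake_ofP _ DG)] [e [z [_ eC ->]]];
  rewrite point_gcomp_opt eC => xE.
  by left; rewrite -xE.
by right; rewrite -xE.
Qed.

(** Isolated from the theorem because it is symmetric in the two shares: the one of value [t] may be
    the interval or its complement. *)
Definition few_components (a b : set point) : Prop :=
  (exists na nb : nat, (na + nb <= #|gcomps| + 2 * r + 4)%N /\
     at_most_comps src tgt a na /\ at_most_comps src tgt b nb) /\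
  ((exists Ci, Ci \in gcomps /\
      (forall C, C \in gcomps -> C != Ci -> GC C `<=` a \/ GC C `<=` b) /\
      at_most_comps src tgt (a `&` GC Ci) (r + 2) /\
      at_most_comps src tgt (b `&` GC Ci) (r + 2))
   \/
   (exists Ci Cj, Ci \in gcomps /\ Cj \in gcomps /\ Ci != Cj /\
      (forall C, C \in gcomps -> C != Ci -> C != Cj ->
         GC C `<=` a \/ GC C `<=` b) /\
      at_most_comps src tgt (a `&` (GC Ci `|` GC Cj)) (r + 3) /\
      at_most_comps src tgt (b `&` (GC Ci `|` GC Cj)) (r + 3))).

Lemma few_components_sym a b : few_components a b -> few_components b a.
Proof.
move=> [[na [nb [le [ha hb]]]] H]; split; first by exists nb, na; rewrite addnC.
case: H => [[Ci [Cg [H [h1 h2]]]]|[Ci [Cj [Cg [Cg' [ne [H [h1 h2]]]]]]]]; [left|right].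
  by exists Ci; do !split => //; move=> C ? ?; apply/or_comm; exact: H.
by exists Ci, Cj; do !split => //; move=> C ? ? ?; apply/or_comm; exact: H.
Qed.

Lemma arc_few_components i j zi zj :
  0 <= zi <= 1 -> 0 <= zj <= 1 -> before i zi j zj ->
  few_components (cake_arc i j zi zj) (cake_coarc i j zi zj).
Proof.
move=> zi01 zj01 ij.
set a := cake_arc _ _ _ _; set b := cake_coarc _ _ _ _.
set Ci := gcomp (src i); set Cj := gcomp (src j).
have CiG : Ci \in gcomps by exact: gcomp_gcomps.
have CjG : Cj \in gcomps by exact: gcomp_gcomps.
have rC C : C \in gcomps -> (radius C <= r)%N by move=> CG; exact: leq_bigmax_cond.
have rCi := rC _ CiG; have rCj := rC _ CjG.
pose other := gcomps :\: [set Ci; Cj].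
pose S := [set C in other | inside i j C].
pose T := [set C in other | ~~ inside i j C].
have otherP C : C \in other -> [/\ C \in gcomps, C != Ci & C != Cj].
  by rewrite !inE negb_or => /andP[/andP[]].
have card : (#|S| + #|T| = #|other|)%N.
  rewrite -(cardsID [set C | inside i j C] other); congr (_ + _)%N.
    by apply: eq_card => C; rewrite !inE.
  by apply: eq_card => C; rewrite !inE andbC.
have SG : S \subset gcomps.
  by apply/fintype.subsetP => C; rewrite inE => /andP[/otherP[]].
have TG : T \subset gcomps.
  by apply/fintype.subsetP => C; rewrite inE => /andP[/otherP[]].
have Sa C : C \in S -> GC C `<=` a.
  by rewrite inE => /andP[/otherP[CG Ci' Cj'] inC]; exact: inside_sub.
have Tb C : C \in T -> GC C `<=` b.
  by rewrite inE => /andP[/otherP[CG Ci' Cj'] inC]; exact: outside_sub.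
have whole C : C \in gcomps -> C != Ci -> C != Cj -> GC C `<=` a \/ GC C `<=` b.
  move=> CG Ci' Cj'; case: (boolP (inside i j C)) => inC.
    by left; exact: inside_sub.
  by right; exact: outside_sub.
have aS p : a p -> (GC Ci `|` GC Cj) p \/ exists2 C, C \in S & GC C p.
  move=> ap; case: (ap) => e [z [z01 pe _ _]].
  have Cp : GC (gcomp (src e)) p.
    by apply/cake_ofP; [exact: gcomp_gcomps|exists e, z].
  have [<-|ei] := eqVneq (gcomp (src e)) Ci; first by left; left.
  have [<-|ej] := eqVneq (gcomp (src e)) Cj; first by left; right.
  right; exists (gcomp (src e)) => //; rewrite !inE negb_or ei ej gcomp_gcomps /=.
  by apply: (arc_inside ei ej ap); rewrite pe point_gcomp_opt.
have bT p : b p -> (GC Ci `|` GC Cj) p \/ exists2 C, C \in T & GC C p.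
  move=> bp; case: (bp) => e [z [z01 pe _]].
  have Cp : GC (gcomp (src e)) p.
    by apply/cake_ofP; [exact: gcomp_gcomps|exists e, z].
  have [<-|ei] := eqVneq (gcomp (src e)) Ci; first by left; left.
  have [<-|ej] := eqVneq (gcomp (src e)) Cj; first by left; right.
  right; exists (gcomp (src e)) => //; rewrite !inE negb_or ei ej gcomp_gcomps /=.
  by apply: (coarc_outside ei ej bp); rewrite pe point_gcomp_opt.
have ac : a `<=` cake src tgt by rewrite -(arc_coarcU i j zi zj); exact: subsetUl.
have bc : b `<=` cake src tgt by rewrite -(arc_coarcU i j zi zj); exact: subsetUr.
(* With both cuts in one component, the total is at most [2 * (r + 2)] plus [s - 1] whole
   components, one below the bound. *)
have [ijC|ijC] := eqVneq Ci Cj.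
  have [la sa ca] := arc_suffix_covers i j zi01 zj01.
  have [lb sb cb] := one_component_coarc_covers zi01 zj01 ijC.
  have {}sa := leq_trans sa (leq_add rCi (leqnn 2)).
  have {}sb := leq_trans sb (leq_add rCi (leqnn 2)).
  have cardo : (#|other| < #|gcomps|)%N.
    rewrite /other -ijC finset.setUid; have := cardsD1 Ci gcomps; rewrite CiG => ->.
    by rewrite add1n.
  rewrite -ijC setUid in aS bT.
  have ca' : covers (a `&` GC Ci) (a `&` GC Ci) la.
    by rewrite -(setUid (GC Ci)); apply: covers_components; rewrite ?setUid.
  have cb' : covers (b `&` GC Ci) (b `&` GC Ci) lb.
    by rewrite -(setUid (GC Ci)); apply: covers_components; rewrite ?setUid.
  split; last first.
    left; exists Ci; do !split => //.
    - by move=> C CG Ci'; apply: whole; rewrite -?ijC.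
    - by apply: (covers_at_most (l := la) (inl (src i))); [by []|exact: ca'].
    - by apply: (covers_at_most (l := lb) (inl (src i))); [by []|exact: cb'].
  exists (r + 2 + #|S|)%N, (r + 2 + #|T|)%N; split; first by lia.
  split.
    by apply: (covers_whole_components (src i) SG Sa aS ca); lia.
  by apply: (covers_whole_components (src i) TG Tb bT cb); lia.
(* With cuts in two components, the total is [2 * (r + 3)] plus [s - 2], which is the bound
   [s + 2 * r + 4]. *)
have [la sa ca] := two_components_arc_covers zi01 zj01 ij ijC.
have [lb sb cb] := two_components_coarc_covers zi01 zj01 ij ijC.
have {}sa := leq_trans sa (leq_add rCi (leqnn 3)).
have {}sb := leq_trans sb (leq_add rCj (leqnn 3)).
have cardo : (#|other| + 2 = #|gcomps|)%N.
  rewrite -(cardsID [set Ci; Cj] gcomps) addnC (finset.setIidPr _) ?cards2 ?ijC //.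
  by apply/fintype.subsetP => C; rewrite !inE => /orP[] /eqP ->.
have ca' := covers_components ac CiG CjG ca.
have cb' := covers_components bc CiG CjG cb.
split; last first.
  right; exists Ci, Cj; do !split => //.
  - by apply: (covers_at_most (l := la) (inl (src i))); [by []|exact: ca'].
  - by apply: (covers_at_most (l := lb) (inl (src i))); [by []|exact: cb'].
exists (r + 3 + #|S|)%N, (r + 3 + #|T|)%N; split; first by lia.
split; first by apply: (covers_whole_components (src i) SG Sa aS ca); lia.
by apply: (covers_whole_components (src i) TG Tb bT cb); lia.
Qed.

(** * Slices of the two shares in the coordinate of an edge *)

Definition offset (i : E) (zi : R) (e : E) : R := (rank i)%:R + zi - (rank e)%:R.

(** A cut on another edge has its offset outside the open unit interval, on the correct side.
    Lexicographic and real comparison can therefore disagree only at the ends of edges. *)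
Lemma before_offset i zi e z : 0 <= zi <= 1 -> 0 < z < 1 ->
  (before i zi e z <-> offset i zi e <= z) /\
  (before e z i zi <-> z <= offset i zi e).
Proof.
move=> zi01 z01; rewrite /offset /before.
case: (ltngtP (rank i) (rank e)) => [lt|gt|/edge_rank_inj ->].
- have le : (rank i)%:R + 1 <= (rank e)%:R :> R by rewrite natr1 ler_nat.
  split; split; [by lra|by left| |by lra].
  by case=> // -[E' _]; move: lt; rewrite E' ltnn.
- have le : (rank e)%:R + 1 <= (rank i)%:R :> R by rewrite natr1 ler_nat.
  split; split; [|by lra|by lra|by left].
  by case=> // -[E' _]; move: gt; rewrite E' ltnn.
- split; split; [by case=> // -[_ ?]; lra|by right; split=> //; lra|
    by case=> // -[_ ?]; lra|by right; split=> //; lra].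
Qed.

Lemma opt_interior e z e' z' : 0 < z < 1 -> 0 <= z' <= 1 ->
  opt e z = opt e' z' -> e = e' /\ z = z'.
Proof.
move=> z01 z'01 Ep; have z01' : 0 <= z <= 1 by lra.
case: (eq_opt z01' z'01 Ep) => // -[v]; rewrite /opt /Defs.pt ifF ?ifF //;
  by apply/eqP; rewrite /orient; case: (flipped e) => ?; lra.
Qed.

Lemma orient_interior e x : 0 < x < 1 -> 0 < orient e x < 1.
Proof. by rewrite /orient; case: (flipped e) => ?; lra. Qed.

Lemma slice_arc i zi j zj e x : 0 <= zi <= 1 -> 0 <= zj <= 1 -> 0 < x < 1 ->
  slice src tgt (cake_arc i j zi zj) e x <->
  offset i zi e <= orient e x <= offset j zj e.
Proof.
move=> zi01 zj01 x01; have o01 := orient_interior e x01.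
have [Hi _] := before_offset i e zi01 o01.
have [_ Hj] := before_offset j e zj01 o01.
split=> [[_ [e' [z' [z'01]]]]|/andP[/Hi ie /Hj ej]]; last first.
  split; first lra.
  by exists e, (orient e x); split; rewrite ?pt_opt//; lra.
rewrite pt_opt => /(opt_interior o01 z'01)[<- <-] /Hi ie /Hj ej.
by rewrite ie ej.
Qed.

Lemma slice_coarc i zi j zj e x : 0 <= zi <= 1 -> 0 <= zj <= 1 -> 0 < x < 1 ->
  slice src tgt (cake_coarc i j zi zj) e x <->
  (orient e x <= offset i zi e \/ offset j zj e <= orient e x).
Proof.
move=> zi01 zj01 x01; have o01 := orient_interior e x01.
have [_ Hi] := before_offset i e zi01 o01.
have [Hj _] := before_offset j e zj01 o01.
split=> [[_ [e' [z' [z'01]]]]|H].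
  rewrite pt_opt => /(opt_interior o01 z'01)[<- <-] [/Hi|/Hj]; by [left|right].
split; first lra.
exists e, (orient e x); split; [lra|by rewrite pt_opt|].
by case: H => [/Hi|/Hj]; [left|right].
Qed.

(** A slice is known explicitly only in the interior of its edge; its ends are added, when present,
    as degenerate intervals. *)
Lemma interior_itv_bigcup (A : set R) (s : seq (interval R)) :
  A `<=` [set x | 0 <= x <= 1] ->
  (forall x, 0 < x < 1 -> A x <-> exists2 I, I \in s & x \in I) ->
  exists s' : seq (interval R), A = \bigcup_(I in [set` s']) [set x | x \in I].
Proof.
move=> A01 As.
pose end_ (x : R) : seq (interval R) := if `[< A x >] then [:: `[x, x]] else [::].
exists ([seq Order.meet K `]0, 1[ | K <- s] ++ end_ 0 ++ end_ 1).
have endP x y I : I \in end_ x -> y \in I -> A y.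
  rewrite /end_; case: asboolP => // Ax; rewrite inE => /eqP ->.
  by rewrite in_itv /= => /andP[? ?]; have -> : y = x by lra.
have end_mem x : A x -> `[x, x] \in end_ x.
  by move=> Ax; rewrite /end_; case: asboolP => // _; rewrite inE.
apply/seteqP; split=> x.
  move=> /[dup] /A01 /= x01 Ax.
  have [x0|x0] := eqVneq x 0.
    exists `[0, 0] => /=; last by rewrite in_itv /= x0 lexx.
    by rewrite !mem_cat end_mem ?orbT // -x0.
  have [x1|x1] := eqVneq x 1.
    exists `[1, 1] => /=; last by rewrite in_itv /= x1 lexx.
    by rewrite !mem_cat end_mem ?orbT // -x1.
  have x01' : 0 < x < 1 by rewrite !lt_neqAle eq_sym x0 x1.
  have [I Is xI] := (As x x01').1 Ax.
  exists (Order.meet I `]0, 1[) => /=; first by rewrite mem_cat; apply/orP; left; apply/mapP; exists I.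
  by rewrite in_itvI xI in_itv.
move=> [I /=]; rewrite !mem_cat => /or3P[/mapP[J Js ->]|/endP H /H//|/endP H /H//].
rewrite in_itvI => /andP[xJ]; rewrite in_itv /= => x01.
by apply: (As x x01).2; exists J.
Qed.

Lemma orient_itv e a b : exists I : interval R,
  forall x, (a <= orient e x <= b) = (x \in I).
Proof.
rewrite /orient; case: (flipped e); [exists `[1 - b, 1 - a]|exists `[a, b]] => x;
  by rewrite in_itv /=; apply/idP/idP => ?; lra.
Qed.

Lemma slice_unit (P : set point) e : slice src tgt P e `<=` [set x | 0 <= x <= 1].
Proof. by move=> x []. Qed.

Lemma piece_arc i zi j zj : 0 <= zi <= 1 -> 0 <= zj <= 1 ->
  piece src tgt (cake_arc i j zi zj).
Proof.
move=> zi01 zj01; split.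
  by rewrite -(arc_coarcU i j zi zj); exact: subsetUl.
move=> e; have [I HI] := orient_itv e (offset i zi e) (offset j zj e).
apply: (@interior_itv_bigcup _ [:: I]); first exact: slice_unit.
move=> x x01; rewrite slice_arc // HI; split=> [xI|[J]].
  by exists I => //; exact: mem_head.
by rewrite inE => /eqP ->.
Qed.

Lemma piece_coarc i zi j zj : 0 <= zi <= 1 -> 0 <= zj <= 1 ->
  piece src tgt (cake_coarc i j zi zj).
Proof.
move=> zi01 zj01; split.
  by rewrite -(arc_coarcU i j zi zj); exact: subsetUr.
move=> e; have [I HI] := orient_itv e 0 (offset i zi e).
have [J HJ] := orient_itv e (offset j zj e) 1.
apply: (@interior_itv_bigcup _ [:: I; J]); first exact: slice_unit.
move=> x x01; have o01 := orient_interior e x01.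
rewrite slice_coarc //; split=> [[?|?]|[K]].
- exists I; first by rewrite mem_head.
  by apply: (etrans (esym (HI x))); lra.
- exists J; first by rewrite !inE eqxx orbT.
  by apply: (etrans (esym (HJ x))); lra.
- rewrite !inE => /orP[] /eqP -> => xK.
    by left; have /andP[] := etrans (HI x) xK.
  by right; have /andP[] := etrans (HJ x) xK.
Qed.

Lemma division_arc i zi j zj : 0 <= zi <= 1 -> 0 <= zj <= 1 ->
  division src tgt (cake_arc i j zi zj) (cake_coarc i j zi zj).
Proof.
move=> zi01 zj01; do !split; [exact: (piece_arc i j zi01 zj01).1|
  exact: (piece_arc i j zi01 zj01).2|exact: (piece_coarc i j zi01 zj01).1|
  exact: (piece_coarc i j zi01 zj01).2|exact: arc_coarcU|exact: arc_coarcI].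
Qed.

Lemma division_sym (a b : set point) : division src tgt a b -> division src tgt b a.
Proof. by move=> [pa [pb [U I]]]; do !split => //; rewrite 1?setUC 1?setIC //; case: pa pb => ? ? []. Qed.

Lemma piece_measurable (P : set point) e : piece src tgt P ->
  measurable (slice src tgt P e).
Proof.
move=> [_ /(_ e)[s ->]]; apply: fin_bigcup_measurable; first exact: finite_seq.
by move=> I _; exact: measurable_itv.
Qed.

(** An integer position is taken as the start of an edge, except at the far end of the segment,
    whence the cap [#|E|.-1]. The rank is given explicitly since its monotonicity in [x] is what
    makes two positions comparable by [before]. *)
Lemma locate (e0 : E) : exists loc : R -> E * R, forall x, 0 <= x <= #|E|%:R ->
  [/\ 0 <= (loc x).2 <= 1, x = (rank (loc x).1)%:R + (loc x).2 &
   rank (loc x).1 = minn (Num.truncn x) #|E|.-1].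
Proof.
have cE : (0 < #|E|)%N by apply/card_gt0P; exists e0.
have surj n : (n < #|E|)%N -> exists e, rank e = n.
  move=> nE; have inj : injective (fun e => Ordinal (edge_rank_lt src tgt e)).
    by move=> e e' [/edge_rank_inj].
  have [g _ gK] := inj_card_bij inj (ltac:(by rewrite card_ord)).
  by exists (g (Ordinal nE)); have := congr1 val (gK (Ordinal nE)).
have [x|loc Hloc] := @boolp.choice R (E * R)%type (fun x p => 0 <= x <= #|E|%:R ->
  [/\ 0 <= p.2 <= 1, x = (rank p.1)%:R + p.2 &
   rank p.1 = minn (Num.truncn x) #|E|.-1]); last by exists loc.
have [x01|/negP nx] := boolP (0 <= x <= #|E|%:R); last by exists (e0, 0).
have lt : (minn (Num.truncn x) #|E|.-1 < #|E|)%N by lia.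
have [e re] := surj _ lt; exists (e, x - (rank e)%:R) => _ /=; split=> //; last by ring.
have /andP[x0 x1] := x01; have := truncn_itv x0; rewrite re => /andP[t1 t2].
case: (leqP (Num.truncn x) #|E|.-1) => [le|gt].
  by rewrite -natr1 in t2; lra.
have E1 : #|E|%:R = #|E|.-1%:R + 1 :> R by rewrite natr1 prednK.
have : #|E|.-1%:R + 1 <= (Num.truncn x)%:R :> R by rewrite natr1 ler_nat.
lra.
Qed.

Lemma loc_before (p q : E * R) (x y : R) : x <= y ->
  x = (rank p.1)%:R + p.2 -> y = (rank q.1)%:R + q.2 ->
  (rank p.1 <= rank q.1)%N -> before p.1 p.2 q.1 q.2.
Proof.
move=> xy Ex Ey; rewrite leq_eqVlt => /orP[/eqP /[dup] rE /edge_rank_inj pq|]; last by left.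
by right; split=> //; move: xy; rewrite Ex Ey rE; lra.
Qed.

(** * The distribution function of a valuation along the segment *)

Variable v : E -> {measure set R -> \bar R}.
Hypothesis vP : valuation v.

Lemma valuation_fin e : (v e `[0%R, 1%R]%classic < +oo)%E.
Proof.
have [_ [_ v1]] := vP; apply: (@le_lt_trans _ _ 1%E); last exact: ltry.
rewrite -v1 (bigD1 e) //= -[leLHS]adde0 leeD2l //.
by apply: sume_ge0 => e' _.
Qed.

Local Notation H := (fun e c => edge_cdf (v e) (flipped e) c).

(** Edges wholly before [x] contribute all their mass and edges wholly after it none, as [edge_cdf]
    is constant on either side of the unit interval. *)
Definition cake_cdf (x : R) : R := \sum_e H e (x - (rank e)%:R).

Let supp e : v e (~` `[0%R, 1%R]%classic) = 0%E. Proof. by case: vP. Qed.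
Let atom e (y : R) : v e [set y] = 0%E. Proof. by case: vP => _ []. Qed.

Lemma cake_cdf_homo : {homo cake_cdf : x y / x <= y}.
Proof.
move=> x y xy; apply: ler_sum => e _.
apply: (edge_cdf_homo (flipped e) (supp e) (atom e) (valuation_fin e)).
by rewrite lerD2r.
Qed.

Lemma cake_cdf_continuous : continuous cake_cdf.
Proof.
have cH e : continuous (fun x : R => H e (x - (rank e)%:R)).
  move=> x; apply: (@continuous_comp _ _ _ (fun y : R => y - (rank e)%:R)).
    by apply: cvgB; [exact: cvg_id|exact: cvg_cst].
  exact: (edge_cdf_continuous (supp e) (atom e) (valuation_fin e)).
rewrite /cake_cdf; elim: (index_enum E) => [|e l IH] x.
  under eq_fun do rewrite big_nil; exact: cvg_cst.
under eq_fun do rewrite big_cons; exact: cvgD (cH e x) (IH x).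
Qed.

Lemma sum_edge_cdf1 : \sum_e H e 1 = 1.
Proof.
apply: EFin_inj; rewrite -sumEFin; have [_ [_ <-]] := vP.
apply: eq_bigr => e _.
by apply: (edge_cdf1 (flipped e) (supp e) (atom e) (valuation_fin e)).
Qed.

Lemma cake_cdf0 : cake_cdf 0 = 0.
Proof.
apply: big1 => e _; apply: (edge_cdf0 (flipped e) (supp e) (atom e) (valuation_fin e)).
by rewrite sub0r oppr_le0 ler0n.
Qed.

Lemma cake_cdf1 : cake_cdf #|E|%:R = 1.
Proof.
rewrite -[RHS]sum_edge_cdf1; apply: eq_bigr => e _; apply: EFin_inj.
have le : 1 <= #|E|%:R - (rank e)%:R :> R.
  by rewrite lerBrDl natr1 ler_nat edge_rank_lt.
by rewrite /= (edge_cdf1 _ (supp e) (atom e) (valuation_fin e) le)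
  (edge_cdf1 _ (supp e) (atom e) (valuation_fin e) (lexx 1)).
Qed.

Lemma value_arc i zi j zj x y : 0 <= zi <= 1 -> 0 <= zj <= 1 ->
  x = (rank i)%:R + zi -> y = (rank j)%:R + zj -> x <= y ->
  value src tgt v (cake_arc i j zi zj) = (cake_cdf y - cake_cdf x)%:E /\
  value src tgt v (cake_coarc i j zi zj) = (1 - (cake_cdf y - cake_cdf x))%:E.
Proof.
move=> zi01 zj01 Ex Ey xy.
rewrite /value /cake_cdf -[X in _ /\ _ = (X - _)%:E]sum_edge_cdf1 -!sumrB -!sumEFin.
split; apply: eq_bigr => e _.
  have le : x - (rank e)%:R <= y - (rank e)%:R by rewrite lerD2r.
  rewrite -(edge_cdf_itv (flipped e) (supp e) (atom e) (valuation_fin e) le).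
  apply: (measure_eq_interior (supp e) (atom e)).
  - by apply: piece_measurable; exact: piece_arc.
  - exact: measurable_orient_itv.
  by move=> u u01; rewrite slice_arc // /offset -Ex -Ey.
have le : x - (rank e)%:R <= y - (rank e)%:R by rewrite lerD2r.
rewrite opprB addrCA.
rewrite -(edge_cdf_outside (flipped e) (supp e) (atom e) (valuation_fin e) le).
apply: (measure_eq_interior (supp e) (atom e)).
- by apply: piece_measurable; exact: piece_coarc.
- exact: measurable_orient_outside.
by move=> u u01; rewrite slice_coarc // /offset -Ex -Ey.
Qed.

End GraphicalCake.

Theorem mainTheorem6 (R : realType) (V E : finType) (src tgt : E -> V)
  (vA vB : E -> {measure set R -> \bar R}) (t : R) :
  valuation vA -> valuation vB -> 0 <= t <= 1 ->
  let s := #|gcomps src tgt| in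
  let r := (\max_(C in gcomps src tgt) graph_radius src tgt C)%N in
  let GC := @cake_of R V E src tgt in
  exists alpha beta : set (gcake_point R V E),
    division src tgt alpha beta /\
    value src tgt vA alpha = t%:E /\ value src tgt vB alpha = t%:E /\
    value src tgt vA beta = (1 - t)%:E /\ value src tgt vB beta = (1 - t)%:E /\
    (exists na nb : nat, (na + nb <= s + 2 * r + 4)%N /\
       at_most_comps src tgt alpha na /\ at_most_comps src tgt beta nb) /\
    ((exists Ci, Ci \in gcomps src tgt /\
        (forall C, C \in gcomps src tgt -> C != Ci ->
           GC C `<=` alpha \/ GC C `<=` beta) /\
        at_most_comps src tgt (alpha `&` GC Ci) (r + 2) /\
        at_most_comps src tgt (beta `&` GC Ci) (r + 2))
     \/
     (exists Ci Cj, Ci \in gcomps src tgt /\ Cj \in gcomps src tgt /\ Ci != Cj /\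
        (forall C, C \in gcomps src tgt -> C != Ci -> C != Cj ->
           GC C `<=` alpha \/ GC C `<=` beta) /\
        at_most_comps src tgt (alpha `&` (GC Ci `|` GC Cj)) (r + 3) /\
        at_most_comps src tgt (beta `&` (GC Ci `|` GC Cj)) (r + 3))).
Proof.
move=> PA PB t01 s r GC.
(* Without edges the total mass would be an empty sum instead of 1. *)
have [e0 _] : exists e : E, True.
  case: (pickP (fun _ : E => true)) => [e _|E0]; first by exists e.
  have [_ [_ +]] := PA; rewrite big_pred0 // => /eqP.
  by rewrite eq_sym onee_eq0.
have [loc Hloc] := locate R src tgt e0.
have [x [y [x0 xy ym Hxy]]] := common_quantile_arc (ler0n R #|E|)
  (@cake_cdf_continuous R V E src tgt vA PA) (@cake_cdf_continuous R V E src tgt vB PB)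
  (@cake_cdf_homo R V E src tgt vA PA) (@cake_cdf_homo R V E src tgt vB PB)
  (cake_cdf0 src tgt PA) (cake_cdf0 src tgt PB)
  (cake_cdf1 src tgt PA) (cake_cdf1 src tgt PB) t01.
have [|zi01 Ex rx] := Hloc x; first by rewrite x0 (le_trans xy).
have [|zj01 Ey ry] := Hloc y; first by rewrite (le_trans x0 xy).
have ij := loc_before (src := src) (tgt := tgt) xy Ex Ey.
have {}ij : before src tgt (loc x).1 (loc x).2 (loc y).1 (loc y).2.
  apply: ij; rewrite rx ry leq_min geq_minr andbT.
  by rewrite (leq_trans (geq_minl _ _)) // le_truncn.
have few := arc_few_components zi01 zj01 ij.
have div := division_arc src tgt (loc x).1 (loc y).1 zi01 zj01.
have [A1 A2] := value_arc PA zi01 zj01 Ex Ey xy.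
have [B1 B2] := value_arc PB zi01 zj01 Ex Ey xy.
(* If the interval has value [1 - t] for both agents, its complement is the share of value [t]. *)
case: Hxy => -[EA EB]; rewrite EA in A1 A2; rewrite EB in B1 B2.
  by exists (cake_arc src tgt (loc x).1 (loc y).1 (loc x).2 (loc y).2),
    (cake_coarc src tgt (loc x).1 (loc y).1 (loc x).2 (loc y).2).
rewrite subKr in A2 B2.
exists (cake_coarc src tgt (loc x).1 (loc y).1 (loc x).2 (loc y).2),
  (cake_arc src tgt (loc x).1 (loc y).1 (loc x).2 (loc y).2).
by have [? ?] := few_components_sym few; have := division_sym div.
Qed.
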